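(* For every $d \in \mathbb{N}_0$, let $\mathfrak{N}_d^{\mathrm{VT}}$ (resp. $\mathfrak{N}_d^{\mathrm{Cay}}$) denote the set of all $n \in \mathbb{N}$ for which there exists a $d$-regular vertex-transitive (resp. Cayley) nut graph of order $n$. Then \[ \mathfrak{N}_d^{\mathrm{VT}} = \mathfrak{N}_d^{\mathrm{Cay}} = \begin{cases} \varnothing, & \text{if $d$ is odd or $d < 4$},\\ \{ n \in \mathbb{N} : n \text{ even},\ n \ge d+4\}, & \text{if } 4 \mid d \text{ and } d \ge 4,\\ \{ n \in \mathbb{N} : 4 \mid n,\ n \ge d+6\}, & \text{if } d \equiv 2 \pmod 4 \text{ and } d \ge 6. \end{cases} \]
   Context: All graphs are finite, simple and undirected. A nut graph is a graph with at least two vertices whose adjacency matrix has eigenvalue $0$ with multiplicity exactly one, such that the corresponding eigenvector (spanning the kernel) has no zero entries. A graph is vertex-transitive if its automorphism group acts transitively on its vertices. For a finite group $\Gamma$ with identity $e$ and a subset $C \subseteq \Gamma\setminus\{e\}$ closed under inversion, $\mathrm{Cay}(\Gamma, C)$ is the graph with vertex set $\Gamma$ in which $u,v$ are adjacent iff $vu^{-1} \in C$; a Cayley graph is a graph isomorphic to some $\mathrm{Cay}(\Gamma,C)$. *)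

(* Defs.v *)
From HB Require Import structures.
From mathcomp Require Import all_boot all_order all_algebra all_fingroup all_field.
Set Implicit Arguments. Unset Strict Implicit. Unset Printing Implicit Defensive.
Import Order.TTheory GRing.Theory Num.Theory.
Local Open Scope ring_scope.

Definition simple_graph (T : finType) (e : rel T) : Prop :=
  (forall x y, e x y = e y x) /\ (forall x, e x x = false).

Definition adjmx (n : nat) (e : rel 'I_n) : 'M[algC]_n :=
  \matrix_(i, j) (e i j)%:R.

Definition nut_graph (n : nat) (e : rel 'I_n) : Prop :=
  (2 <= n)%N /\
  mup 0 (char_poly (adjmx e)) = 1%N /\
  exists v : 'cV[algC]_n, adjmx e *m v = 0 /\ forall i, v i 0 != 0.

Definition regular (T : finType) (e : rel T) (d : nat) : Prop :=
  forall v : T, #|[set w | e v w]| = d.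

Definition is_graph_aut (T : finType) (e : rel T) (s : {perm T}) : Prop :=
  forall x y, e (s x) (s y) = e x y.

Definition vertex_transitive (T : finType) (e : rel T) : Prop :=
  forall u v : T, exists s : {perm T}, is_graph_aut e s /\ s u = v.

Definition cayley_rel (gT : finGroupType) (C : {set gT}) : rel gT :=
  fun u v => (v * u^-1)%g \in C.

Definition cayley_set (gT : finGroupType) (C : {set gT}) : Prop :=
  (1%g \notin C) /\ (forall x, x \in C -> (x^-1)%g \in C).

Definition is_cayley (T : finType) (e : rel T) : Prop :=
  exists (gT : finGroupType) (C : {set gT}) (f : T -> gT),
    cayley_set C /\ bijective f /\
    forall x y, e x y = cayley_rel C (f x) (f y).

Definition NVT (d n : nat) : Prop :=
  exists e : rel 'I_n, [/\ simple_graph e, regular e d,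
                          vertex_transitive e & nut_graph e].

Definition NCay (d n : nat) : Prop :=
  exists e : rel 'I_n, [/\ simple_graph e, regular e d,
                          is_cayley e & nut_graph e].

Definition Nset (d n : nat) : Prop :=
  if odd d || (d < 4)%N then False
  else if (4 %| d)%N then [/\ (0 < n)%N, ~~ odd n & (d + 4 <= n)%N]
  else [/\ (0 < n)%N, (4 %| n)%N & (d + 6 <= n)%N].

(* Main.v *)
Require Import Defs.
From HB Require Import structures.
From mathcomp Require Import all_boot all_order all_algebra all_fingroup all_field.
From mathcomp Require Import zify ring.
Set Implicit Arguments. Unset Strict Implicit. Unset Printing Implicit Defensive.
Import Order.TTheory GRing.Theory Num.Theory.
Local Open Scope ring_scope.

(** A kernel vector [v] of a vertex-transitive nut graph can be scaled to have
    entries [1] and [-1]: after scaling it is real, and an automorphism maps it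
    to a multiple of itself by a real root of unity. So every vertex has as many
    positive as negative neighbours, which yields the parity conditions by
    double counting. Order [d + 2] is excluded by twins. In degree [2],
    restricting [v] to an orbit of "go to the neighbour of equal sign, then to
    its neighbour of opposite sign" gives a second independent kernel vector.

    For existence take [Cay(D_m, C)], [D_m] dihedral of order [2 m], where [C]
    has rotation part [S = -S] and reflection part [T], and put
    [X(z) = \sum_(j in S) z ^ j], [Y(z) = \sum_(j in T) z ^ j]. A Fourier
    transform shows that the kernel is spanned by one explicit sign vector as
    soon as [X(z)^2 <> Y(z) Y(1/z)] for all [m]-th roots of unity [z] but one
    (usually [z = 1], where [X = Y]). If [T = -T], this means [X <> Y] and
    [X <> - Y], and if moreover [S] and [T] differ, up to [0] and [m/2], only in
    the pairs [{a, -a}] and [{b, -b}], then [X = Y] or [X = - Y] forces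
    [z^a + z^-a - z^b - z^-b] to be divisible by [2] in the algebraic integers.
    For [a + b] and [a - b] coprime to [m] this implies [2 | (1 - z)^2], hence
    [z^4 = 1], and only [z = -1] and [z^2 = -1] remain to be inspected. *)

(** * Simple zero eigenvalues of symmetric matrices *)

Lemma mup_prod_XsubC (F : fieldType) (I : Type) (r : seq I) (f : I -> F) x :
  mup x (\prod_(i <- r) ('X - (f i)%:P)) = count (fun i => f i == x) r.
Proof.
elim: r => [|i r IH]; first by rewrite big_nil mupNroot // root1.
rewrite big_cons mupM ?polyXsubC_eq0 //; last first.
  by rewrite prodf_seq_neq0 (eq_all (a2 := predT)) ?all_predT // => j; rewrite polyXsubC_eq0.
by rewrite IH -['X - _]expr1 mup_XsubCX /=; case: eqP.
Qed.

Lemma char_poly_conj (F : fieldType) n (P D : 'M[F]_n) : P \in unitmx ->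
  char_poly (invmx P *m D *m P) = char_poly D.
Proof.
move=> uP; rewrite /char_poly /char_poly_mx.
have uP' : map_mx polyC P \in unitmx by rewrite map_unitmx.
have -> : 'X%:M - map_mx polyC (invmx P *m D *m P) =
  invmx (map_mx polyC P) *m ('X%:M - map_mx polyC D) *m map_mx polyC P.
  rewrite !map_mxM /= map_invmx mulmxBr mulmxBl; congr (_ - _).
  by rewrite scalar_mxC -mulmxA mulVmx // mulmx1.
by rewrite !det_mulmx mulrAC -det_mulmx mulVmx // det1 mul1r.
Qed.

(** A real symmetric matrix is diagonalizable by the spectral theorem, so the multiplicity of the
    root 0 counts the zero entries of the diagonal form, which is also the dimension of the
    kernel. *)
Lemma mup0_char_poly_symmetric n (A : 'M[algC]_n) (v : 'cV[algC]_n) :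
  A \is symmetricmx -> A \is a realmx -> v != 0 -> A *m v = 0 ->
  (mup 0 (char_poly A) = 1%N <->
   forall w : 'cV[algC]_n, A *m w = 0 -> exists c, w = c *: v).
Proof.
move=> sA rA v0 Av; have /orthomx_spectralP := symmetric_normalmx sA rA.
have uP := spectral_unit A.
move: (spectralmx A) (spectral_diag A) uP => P d uP defA.
have kerA (w : 'cV_n) : A *m w = 0 <-> forall i, d 0 i != 0 -> (P *m w) i 0 = 0.
  rewrite defA -!mulmxA; split=> [/(congr1 (mulmx P))|H].
    rewrite mulKVmx // mulmx0 => /matrixP H i di; have:= H i 0.
    by rewrite mul_diag_mx !mxE => /eqP; rewrite mulf_eq0 (negPf di) => /eqP.
  rewrite mul_diag_mx; apply: (canLR (mulKmx uP)).
  rewrite mulmx0; apply/matrixP=> i j; rewrite (ord1 j) mxE [RHS]mxE.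
  by case: (eqVneq (d 0 i) 0) => [->|/H ->]; rewrite ?mul0r ?mulr0.
have -> : mup 0 (char_poly A) = #|[pred i | d 0 i == 0]|.
  rewrite defA (char_poly_conj _ uP) char_poly_trig ?diag_mx_is_trig //.
  under eq_bigr do rewrite mxE eqxx mulr1n.
  by rewrite mup_prod_XsubC cardE /enum_mem size_filter.
have Pinj (w : 'cV_n) : P *m w = 0 -> w = 0.
  by move=> /(congr1 (mulmx (invmx P))); rewrite mulKmx // mulmx0.
have ker_delta i : d 0 i = 0 -> A *m (invmx P *m (delta_mx i 0 : 'cV_n)) = 0.
  move=> di; apply/kerA=> j dj; rewrite mulKVmx // mxE.
  by have /negPf-> : j != i by apply: contra dj => /eqP->; apply/eqP.
split=> [/mem_card1 [i0 Hi0] w|H].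
  have di i : i != i0 -> d 0 i != 0 by move=> ni; have:= Hi0 i; rewrite !inE (negPf ni) => ->.
  have coll (u : 'cV_n) : A *m u = 0 -> P *m u = (P *m u) i0 0 *: delta_mx i0 0.
    move=> /kerA Hu; apply/matrixP=> i j; rewrite (ord1 j) [RHS]mxE [delta_mx _ _ _ _]mxE eqxx andbT.
    by case: (eqVneq i i0) => [->|/di/Hu ->]; rewrite ?mulr1 ?mulr0.
  have c0 : (P *m v) i0 0 != 0.
    by apply: contra v0 => /eqP c0; rewrite (Pinj v) // coll // c0 scale0r.
  move=> /coll; have /coll := Av; move: c0; set cv := (P *m v) i0 0.
  set cw := (P *m w) i0 0 => c0 Ev Ew; exists (cw / cv); apply/eqP.
  rewrite -subr_eq0; apply/eqP/Pinj.
  by rewrite mulmxBr -scalemxAr Ew Ev scalerA divfK // subrr.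
(* Without a zero on the diagonal [v] would vanish; two zero positions would make two distinct basis
   vectors multiples of the same [P *m v]. *)
have /existsP[i /eqP di] : [exists i, d 0 i == 0].
  apply: contraNT v0 => /existsPn dn.
  apply/eqP/Pinj/matrixP=> i j; rewrite (ord1 j).
  by have /kerA/(_ i (dn i)) -> := Av; rewrite mxE.
apply: (@eq_card1 _ i) => j; rewrite !inE; apply/eqP/eqP=> [dj|-> //].
have [[ci Hi] [cj Hj]] := (H _ (ker_delta i di), H _ (ker_delta j dj)).
have e_eq k c : invmx P *m (delta_mx k 0 : 'cV_n) = c *: v -> delta_mx k 0 = c *: (P *m v).
  by move=> E; rewrite scalemxAr -E mulKVmx.
have /matrixP/(_ i 0) := e_eq _ _ Hi; have /matrixP/(_ j 0) := e_eq _ _ Hj.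
have /matrixP/(_ i 0) := e_eq _ _ Hj; rewrite ![delta_mx _ _ _ _]mxE !eqxx !andbT.
case: (eqVneq i j) => // _ /esym/eqP; rewrite mxE mulf_eq0 => /orP[] /eqP E.
  by rewrite E scale0r mxE => /eqP; rewrite oner_eq0.
by move=> _; rewrite mxE E mulr0 => /eqP; rewrite oner_eq0.
Qed.

(** Kernel vectors are functions on an arbitrary finite vertex set, so that a Cayley graph can be
    treated on its group. *)
Definition adj_null (T : finType) (e : rel T) (w : T -> algC) : Prop :=
  forall x, \sum_(y | e x y) w y = 0.

Lemma adjmx_kernelE n (e : rel 'I_n) (w : 'cV[algC]_n) :
  adjmx e *m w = 0 <-> adj_null e (fun i => w i 0).
Proof.
have E i : (adjmx e *m w) i 0 = \sum_(y | e i y) w y 0.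
  rewrite mxE [RHS]big_mkcond; apply: eq_bigr => j _.
  by rewrite mxE; case: (e i j); rewrite ?mul1r ?mul0r.
split=> [Aw i|H]; first by rewrite -E Aw mxE.
by apply/matrixP=> i j; rewrite (ord1 j) E H mxE.
Qed.

Lemma nut_graphE n (e : rel 'I_n) : simple_graph e ->
  nut_graph e <-> (2 <= n)%N /\
    exists v : 'I_n -> algC, [/\ forall i, v i != 0, adj_null e v &
      forall w, adj_null e w -> exists c, forall i, w i = c * v i].
Proof.
case=> esym eirr.
have sA : adjmx e \is symmetricmx.
  by apply/is_hermitianmxP; rewrite scale1r map_mx_id //; apply/matrixP=> i j; rewrite !mxE esym.
have rA : adjmx e \is a realmx.
  by apply/mxOverP=> i j; rewrite mxE realn.
have v0 (v : 'cV[algC]_n) : (2 <= n)%N -> (forall i, v i 0 != 0) -> v != 0.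
  case: n {e esym eirr sA rA} v => // n v _ /(_ 0) v0.
  by apply: contra v0 => /eqP ->; rewrite mxE.
split=> [[n2 [mu1 [v [Av vn0]]]]|[n2 [v [vn0 kv spanv]]]]; split=> //.
  have muP := mup0_char_poly_symmetric sA rA (v0 v n2 vn0) Av.
  exists (fun i => v i 0); split=> // [|w kw]; first exact/adjmx_kernelE.
  have /(muP.1 mu1) [c Hc] : adjmx e *m \col_i w i = 0.
    by apply/adjmx_kernelE=> x; rewrite -[RHS](kw x); apply: eq_bigr => y _; rewrite mxE.
  by exists c => i; have /matrixP/(_ i 0) := Hc; rewrite !mxE.
have vcn0 i : (\col_i v i) i 0 != 0 by rewrite mxE.
have Av : adjmx e *m \col_i v i = 0.
  by apply/adjmx_kernelE=> x; rewrite -[RHS](kv x); apply: eq_bigr => y _; rewrite mxE.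
split; last by exists (\col_i v i).
apply/(mup0_char_poly_symmetric sA rA (v0 _ n2 vcn0) Av) => w /adjmx_kernelE/spanv [c Hc].
by exists c; apply/matrixP=> i j; rewrite (ord1 j) Hc !mxE.
Qed.

Lemma vt_null_sign n (e : rel 'I_n) (v : 'I_n -> algC) :
  vertex_transitive e -> (0 < n)%N -> (forall i, v i != 0) -> adj_null e v ->
  (forall w, adj_null e w -> exists c, forall i, w i = c * v i) ->
  exists b : 'I_n -> bool, adj_null e (fun i => (-1) ^+ b i) /\
  (forall w, adj_null e w -> exists c, forall i, w i = c * (-1) ^+ b i).
Proof.
move=> vt n0 vn0 kv spanv.
pose x0 : 'I_n := Ordinal n0.
pose u i := v i / v x0.
have ux0 : u x0 = 1 by rewrite /u divff.
have ku : adj_null e u by move=> x; rewrite -mulr_suml kv mul0r.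
have spanu w : adj_null e w -> exists c, forall i, w i = c * u i.
  move=> /spanv [c Hc]; exists (c * v x0) => i.
  by rewrite Hc /u mulrA mulrAC mulfK.
(* The adjacency matrix is real, so the conjugate of [u] is a multiple of [u]; the value 1 at [x0]
   makes the factor 1. *)
have ureal x : u x \is Num.real.
  have /spanu [c Hc] : adj_null e (fun x => (u x)^*).
    by move=> y; rewrite -rmorph_sum ku rmorph0.
  have c1 : c = 1 by have := Hc x0; rewrite ux0 mulr1 conjC1.
  by apply/CrealP; rewrite Hc c1 mul1r.
have usign x : u x = 1 \/ u x = -1.
  have [s [sA sx]] := vt x0 x.
  have /spanu [c Hc] : adj_null e (fun y => u (s y)).
    move=> y; rewrite -[RHS](ku (s y)) [RHS](reindex_inj (@perm_inj _ s)).
    by apply: eq_bigl => z; rewrite sA.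
  have cE : c = u x by have := Hc x0; rewrite sx ux0 mulr1.
  (* Along the orbit of [x0] under [s] the values are powers of [c]. Since [s] has finite order, [c]
     has modulus 1, and a real number of modulus 1 is a sign. *)
  have Hk k : u ((s ^+ k)%g x0) = c ^+ k.
    elim: k => [|k IH]; first by rewrite expg0 perm1 ux0.
    by rewrite expgSr permM Hc IH exprS.
  have := Hk #[s]%g; rewrite expg_order perm1 ux0 cE => /esym uN.
  have /eqP : `|u x| ^+ #[s]%g == 1 by rewrite -normrX uN normr1.
  move/eqP; rewrite pexpr_eq1 // => /eqP n1.
  have := realEsign (ureal x); rewrite n1 mulr1 => ->.
  by case: (u x < 0); [right|left]; rewrite ?expr1 ?expr0.
exists (fun i => u i == -1).
have E i : (-1) ^+ (u i == -1) = u i.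
  case: (usign i) => ->; last by rewrite eqxx.
  have /negPf -> // : (1 : algC) != -1.
  by rewrite -subr_eq0 opprK -(natrD _ 1 1) pnatr_eq0.
split; first by move=> x; under eq_bigr do rewrite E.
by move=> w /spanu [c Hc]; exists c => i; rewrite E.
Qed.

(** * Necessary conditions *)

(** Right translations preserve [v * u^-1] and act transitively. *)
Lemma NCay_NVT d n : NCay d n -> NVT d n.
Proof.
case=> e [sg rg [gT [C [f [_ [[g fK gK] eE]]]]] ng].
exists e; split=> // u v.
have h_inj : injective (fun x => g (f x * ((f u)^-1 * f v))%g).
  by move=> x y /(can_inj gK)/mulIg/(can_inj fK).
exists (perm h_inj); split; last by rewrite permE mulKVg fK.
by move=> x y; rewrite !permE !eE /cayley_rel !gK; congr (_ \in C); move: ((f u)^-1 * f v)%g => w; rewrite invMg mulgA mulgK.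
Qed.

(** Degree sum in the subgraph induced on [P]: ordering the ends of each edge splits it into two
    equal halves. *)
Lemma handshake n (e : rel 'I_n) (P : pred 'I_n) : simple_graph e ->
  ~~ odd (\sum_(x | P x) #|[pred y | e x y && P y]|).
Proof.
case=> esym eirr.
have E : (\sum_(x | P x) #|[pred y | e x y && P y]| =
   \sum_(x | P x) \sum_(y | P y) (e x y && (x < y)) +
   \sum_(x | P x) \sum_(y | P y) (e x y && (y < x)))%N.
  rewrite -big_split; apply: eq_bigr => x _ /=; rewrite -big_split -sum1_card.
  rewrite [RHS]big_mkcond [LHS]big_mkcond; apply: eq_bigr => y _ /=.
  rewrite !inE; case: (P y); rewrite ?andbF ?andbT //.
  by case: (ltngtP x y) => [||/val_inj ->]; rewrite ?eirr ?andbF ?andbT ?addn0.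
rewrite E [X in (_ + X)%N]exchange_big /=.
set s1 := (X in (X + _)%N); set s2 := (X in (_ + X)%N).
suff -> : s2 = s1 by rewrite addnn odd_double.
by apply: eq_bigr => x _; apply: eq_bigr => y _; rewrite esym.
Qed.

Lemma signed_card (T : finType) (A b : pred T) :
  \sum_(y | A y) (-1 : algC) ^+ b y = 0 ->
  #|[pred y | A y && b y]| = #|[pred y | A y && ~~ b y]|.
Proof.
rewrite (bigID b) /= => /eqP.
have -> : \sum_(y | A y && b y) (-1 : algC) ^+ b y = - #|[pred y | A y && b y]|%:R.
  by rewrite (eq_bigr (fun=> -1)) => [|i /andP[_ ->] //]; rewrite sumr_const mulNrn.
have -> : \sum_(y | A y && ~~ b y) (-1 : algC) ^+ b y = #|[pred y | A y && ~~ b y]|%:R.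
  by rewrite (eq_bigr (fun=> 1)) => [|i /andP[_ /negPf ->] //]; rewrite sumr_const.
by rewrite addrC subr_eq0 eqr_nat => /eqP.
Qed.

(** * Consequences of a spanning sign vector *)

Section Sign.
Variables (d n : nat) (e : rel 'I_n) (b : 'I_n -> bool).
Hypotheses (sg : simple_graph e) (rg : regular e d) (n2 : (2 <= n)%N).
Hypotheses (kb : adj_null e (fun i => (-1) ^+ b i))
  (spanb : forall w, adj_null e w -> exists c, forall i, w i = c * (-1) ^+ b i).

(** The exclusions of degree 0, degree 2 and order [d + 2] each produce a kernel vector that has
    both a zero and a nonzero entry. *)
Lemma adj_null_neq0 w x y : adj_null e w -> w x = 0 -> w y = 0.
Proof.
move=> /spanb[c Hc]; rewrite !Hc => /eqP.
by rewrite mulf_eq0 signr_eq0 orbF => /eqP ->; rewrite mul0r.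
Qed.

Lemma card_nbr x : #|[pred y | e x y]| = d.
Proof. by rewrite -(rg x) cardsE. Qed.

Lemma card_nbr_sign x : #|[pred y | e x y && b y]| = d./2 /\
                        #|[pred y | e x y && ~~ b y]| = d./2 /\ ~~ odd d.
Proof.
have E := signed_card (kb x); have := cardID b [pred y | e x y].
rewrite card_nbr (eq_card (B := [pred y | e x y && b y])); last by move=> y; rewrite !inE andbC.
rewrite [X in (_ + X)%N](eq_card (B := [pred y | e x y && ~~ b y])); last by move=> y; rewrite !inE andbC.
by rewrite -E addnn => <-; rewrite doubleK odd_double.
Qed.

Lemma degree_even : ~~ odd d.
Proof. by have [_ []] := card_nbr_sign (Ordinal (ltnW n2)). Qed.

Lemma other_vertex (x : 'I_n) : exists y, y != x.
Proof.
apply/existsP; rewrite -negb_forall; apply/negP => /forallP H.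
have := card_ord n; rewrite (eq_card1 (x := x)) => [|y]; last by rewrite !inE (H y).
lia.
Qed.

Lemma degree_neq0 : (d != 0)%N.
Proof.
apply/eqP=> d0.
have ne x y : e x y = false by move: (card_nbr x); rewrite d0 => /card0_eq/(_ y).
pose x : 'I_n := Ordinal (ltnW n2); have [y yx] := other_vertex x.
have k : adj_null e (fun z => (z == x)%:R) by move=> z; rewrite big_pred0.
have := adj_null_neq0 (x := y) x k; rewrite (negPf yx) eqxx => /(_ erefl)/eqP.
by rewrite oner_eq0.
Qed.

(** Double counting of the adjacent pairs whose second member lies in the class [b]: every vertex
    has [d / 2] neighbours there, and every member of the class has degree [d]. *)
Lemma order_double : n = (#|b|).*2.
Proof.
have := degree_neq0; have := degree_even => de d0.
have H : (\sum_x #|[pred y | e x y && b y]| = #|b| * d)%N.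
  transitivity (\sum_x \sum_(y | b y) (e y x : nat))%N.
    apply: eq_bigr => x _; rewrite -sum1_card big_mkcond [RHS]big_mkcond.
    by apply: eq_bigr => y _ /=; rewrite inE sg.1; case: (b y); case: (e y x).
  rewrite exchange_big /= (eq_bigr (fun=> d)) ?sum_nat_const // => y _.
  by rewrite -(card_nbr y) -sum1_card [RHS]big_mkcond; apply: eq_bigr => x _; rewrite inE; case: (e y x).
move: H; rewrite (eq_bigr (fun=> d./2)); last by move=> x _; have [] := card_nbr_sign x.
rewrite sum_nat_const card_ord -{2}(even_halfK de) -doubleMr doubleMl => /eqP.
by rewrite eqn_pmul2r => [/eqP //|]; lia.
Qed.

Lemma degree_gt2 : (d != 2)%N.
Proof.
apply/eqP=> d2.
(* [s x] and [o x] are the two neighbours of [x], of equal and of opposite sign; both maps are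
   involutions without fixed points. *)
have [s Hs] : exists s, forall x y, (e x y && (b y == b x)) = (y == s x).
  suff /fin_all_exists [s Hs] : forall x, exists z, forall y, (e x y && (b y == b x)) = (y == z).
    by exists s.
  move=> x; have : #|[pred y | e x y && (b y == b x)]| = 1%N.
    have [H1 [H2 _]] := card_nbr_sign x; rewrite d2 /= in H1 H2.
    by case: (b x); [rewrite -H1|rewrite -H2]; apply: eq_card => y; rewrite !inE; case: (b y).
  by move=> /mem_card1[z Hz]; exists z => y; have := Hz y; rewrite !inE.
have [o Ho] : exists o, forall x y, (e x y && (b y != b x)) = (y == o x).
  suff /fin_all_exists [s' Hs'] : forall x, exists z, forall y, (e x y && (b y != b x)) = (y == z).
    by exists s'.
  move=> x; have : #|[pred y | e x y && (b y != b x)]| = 1%N.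
    have [H1 [H2 _]] := card_nbr_sign x; rewrite d2 /= in H1 H2.
    by case: (b x); [rewrite -H2|rewrite -H1]; apply: eq_card => y; rewrite !inE; case: (b y).
  by move=> /mem_card1[z Hz]; exists z => y; have := Hz y; rewrite !inE.
have es x : e x (s x) /\ b (s x) = b x by move: (Hs x (s x)); rewrite eqxx => /andP[-> /eqP].
have eo x : e x (o x) /\ b (o x) != b x by move: (Ho x (o x)); rewrite eqxx => /andP[->].
have ss x : s (s x) = x.
  by apply/esym/eqP; rewrite -Hs (es x).2 eqxx sg.1 (es x).1.
have oo x : o (o x) = x.
  by apply/esym/eqP; rewrite -Ho eq_sym (eo x).2 sg.1 (eo x).1.
have sx x : s x != x by apply: contraTneq (es x).1 => ->; rewrite sg.2.
have ox x : o x != x by apply: contraTneq (eo x).1 => ->; rewrite sg.2.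
pose p x := o (s x).
have p_inj : injective p by apply: inj_comp (can_inj oo) (can_inj ss).
have bp x : b (p x) = ~~ b x.
  by have := (eo (s x)).2; rewrite (es x).2 /p; case: (b x); case: (b _).
(* The involution [s] inverts [p], so [s x = p^k x] passes to [p x] with [k - 2], down to a fixed
   point of [s] or of [o]. *)
have no_refl k x : s x <> iter k p x.
  have [m] := ubnP k; elim: m k x => // m IH [|[|k]] x km.
  - by move/eqP; rewrite (negPf (sx x)).
  - by move/esym/eqP; rewrite /= /p (negPf (ox _)).
  - rewrite iterSr iterS => E; apply: (IH k (p x)); first by lia.
    by rewrite {1}/p E [p (iter _ _ _)]/p oo ss.
pose x0 : 'I_n := Ordinal (ltnW n2).
(* The neighbours [s x] and [p (s x)] of [x] lie in one orbit of [p] and have opposite signs, so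
   restricting the sign vector to an orbit keeps it in the kernel, while [s x0] lies outside the
   orbit of [x0]. *)
pose w x : algC := if fconnect p x0 x then (-1) ^+ b x else 0.
have kw : adj_null e w.
  move=> x; rewrite (bigID (fun y => b y == b x)) /= (big_pred1 (s x)); last by move=> y; rewrite Hs.
  rewrite (big_pred1 (o x)); last by move=> y; rewrite Ho.
  have -> : o x = p (s x) by rewrite /p ss.
  rewrite /w -(same_fconnect1_r p_inj) bp; case: ifP => _; last by rewrite addr0.
  by rewrite signrN subrr.
have := adj_null_neq0 (x := s x0) x0 kw.
rewrite {2}/w connect0 /w; case: ifP => [/iter_findex E _|_ /(_ erefl)/eqP]; last first.
  by rewrite signr_eq0.
by case: (no_refl _ _ (esym E)).
Qed.

Lemma order_gt : (d + 2 < n)%N.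
Proof.
have nd := order_double; have d0 := degree_neq0; have de := degree_even.
have cD x : (#|[pred y | (y != x) && ~~ e x y]| + 1 + d)%N = n.
  have := cardC [pred y | e x y]; rewrite card_nbr card_ord (cardD1 x [predC _]).
  rewrite !inE sg.2 /= => E; rewrite -[RHS]E [RHS]addnC; congr (_ + _)%N.
  by rewrite addnC; congr (_ + _)%N; apply: eq_card => y; rewrite !inE.
rewrite ltnNge; apply/negP => le_n.
(* Parity rules out [n = d + 1], so every vertex has exactly one non-neighbour besides itself, and
   the two turn out to be twins. *)
have part x : exists x', forall y, (y != x) && ~~ e x y = (y == x').
  have /mem_card1[x' Hx'] : #|[pred y | (y != x) && ~~ e x y]| = 1%N by have := cD x; lia.
  by exists x' => y; have := Hx' y; rewrite !inE.
pose x : 'I_n := Ordinal (ltnW n2); have [x' Hx] := part x; have [x'' Hx'] := part x'.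
have /andP[x'x nex] : (x' != x) && ~~ e x x' by rewrite Hx.
have xx'' : x'' = x by apply/esym/eqP; rewrite -Hx' eq_sym x'x sg.1.
have twin y : e y x = e y x'.
  rewrite !(sg.1 y); have := Hx y; have := Hx' y; rewrite xx''.
  case: (eqVneq y x) => [->|yx]; first by rewrite sg.2 sg.1 (negPf nex).
  case: (eqVneq y x') => [->|yx'] /=; first by rewrite sg.2 (negPf nex).
  by case: (e x y); case: (e x' y).
have kw : adj_null e (fun z => (z == x)%:R - (z == x')%:R).
  have S y u : \sum_(z | e y z) (z == u)%:R = (e y u)%:R :> algC.
    case: (boolP (e y u)) => eyu; last first.
      by rewrite big1 // => z eyz; have /negPf-> : z != u by apply: contraNneq eyu => <-.
    by rewrite (bigD1 u) //= eqxx big1 ?addr0 // => z /andP[_ /negPf->].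
  by move=> y; rewrite big_split sumrN /= !S twin subrr.
have /card_gt0P[y] : (0 < #|[pred y | e x y]|)%N by rewrite card_nbr lt0n.
rewrite inE => exy.
have yx : (y == x) = false by apply: contraTF exy => /eqP ->; rewrite sg.2.
have yx' : (y == x') = false by apply: contraTF exy => /eqP ->.
have := adj_null_neq0 (x := y) x kw.
rewrite yx yx' subrr eqxx eq_sym (negPf x'x) subr0 => /(_ erefl)/eqP.
by rewrite oner_eq0.
Qed.

Lemma Nset_of_sign : Nset d n.
Proof.
have nd := order_double; have d0 := degree_neq0; have de := degree_even; have dn2 := degree_gt2.
have ndgt := order_gt.
(* The subgraph induced on [b] is regular of degree [d / 2]; if this is odd, the handshake lemma
   makes [#|b| = n / 2] even. *)
have H : ~~ (4 %| d)%N -> ~~ odd #|b|.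
  have := handshake b sg; rewrite (eq_bigr (fun=> d./2)); last first.
    by move=> x _; have [] := card_nbr_sign x.
  rewrite sum_nat_const oddM => + nd4.
  suff -> : odd d./2 by rewrite andbT.
  apply: contraR nd4 => /even_halfK E; rewrite -(even_halfK de) -E.
  by apply/dvdnP; exists (d./2./2); lia.
rewrite /Nset (negPf de) /=; case: ifP => [|_]; first by lia.
by case: ifP => [_|/negbT nd4]; [|have := H nd4]; split; lia.
Qed.

End Sign.

Lemma NVT_Nset d n : NVT d n -> Nset d n.
Proof.
case=> e [sg rg vt] /(nut_graphE sg) [n2 [v [vn0 kv spanv]]].
have [b [kb sb]] := vt_null_sign vt (ltnW n2) vn0 kv spanv.
exact: Nset_of_sign sg rg n2 kb sb.
Qed.

(** * Cayley graphs of dihedral groups *)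

Section CayleyTransfer.
Variables (gT : finGroupType) (C : {set gT}).

Lemma adj_null_cayleyE (w : gT -> algC) :
  adj_null (cayley_rel C) w <-> forall x, \sum_(c in C) w (c * x)%g = 0.
Proof.
have E x : \sum_(y | cayley_rel C x y) w y = \sum_(c in C) w (c * x)%g.
  rewrite (reindex_inj (mulIg x)); apply: eq_bigl => c.
  by rewrite /cayley_rel mulgK.
by split=> H x; [rewrite -E|rewrite E]; exact: H.
Qed.

Lemma NCay_of_group (v : gT -> algC) : cayley_set C -> (2 <= #|gT|)%N ->
  (forall x, v x != 0) -> adj_null (cayley_rel C) v ->
  (forall w, adj_null (cayley_rel C) w -> exists c, forall x, w x = c * v x) ->
  NCay #|C| #|gT|.
Proof.
move=> [C1 CV] g2 v0 kv spanv.
pose f : 'I_#|gT| -> gT := @enum_val gT predT.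
have fbij : bijective f by exact: enum_val_bij.
have [g fK gK] := fbij.
have sg : simple_graph (fun x y => cayley_rel C (f x) (f y)).
  split=> [x y|x]; last by rewrite /cayley_rel mulgV; apply: negbTE.
  by apply/idP/idP=> /CV; rewrite /cayley_rel invMg invgK.
have kE w : adj_null (fun x y => cayley_rel C (f x) (f y)) w <->
            adj_null (cayley_rel C) (w \o g).
  have E x : \sum_(y | cayley_rel C x y) w (g y) = \sum_(y | cayley_rel C x (f y)) w y.
    rewrite (reindex f) /=; last exact: onW_bij.
    by apply: eq_bigr => y _; rewrite fK.
  by split=> H x; [rewrite E -[x]gK|rewrite -E]; exact: H.
exists (fun x y => cayley_rel C (f x) (f y)); split=> //.
- move=> x; have cinj : injective (fun c => g (c * f x)%g).
    by move=> c c' /(can_inj gK)/mulIg.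
  rewrite -(card_imset _ cinj); apply: eq_card => y; rewrite inE.
  apply/idP/imsetP=> [Cy|[c Cc ->]]; last by rewrite /cayley_rel gK mulgK.
  by exists (f y * (f x)^-1)%g; rewrite // mulgKV fK.
- by exists gT, C, f.
apply/(nut_graphE sg); split=> //; exists (v \o f); split=> [i||w /kE /spanv[c Hc]].
- exact: v0.
- by apply/kE=> x; rewrite -[RHS](kv x); apply: eq_bigr => y _; rewrite /= gK.
by exists c => i; rewrite /= -Hc /= fK.
Qed.
End CayleyTransfer.

Section DihedralGroup.
Variable m : nat.

(* [(false, i)] is the rotation by [i] and [(true, i)] a reflection. *)
Definition dih : Type := (bool * 'Z_m)%type.
HB.instance Definition _ := Finite.on dih.

Definition dih_mul (x y : dih) : dih :=
  (x.1 (+) y.1, (if y.1 then - x.2 else x.2) + y.2).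
Definition dih_inv (x : dih) : dih := (x.1, if x.1 then x.2 else - x.2).

Fact dih_mulA : associative dih_mul.
Proof.
case=> [p i] [[] j] [[] k]; rewrite /dih_mul /= ?addbF ?addbT ?negbK ?opprD ?opprK; congr (_, _);
  by rewrite ?addrA.
Qed.
Fact dih_mul1 : left_id (false, 0) dih_mul.
Proof. by case=> [[] i]; rewrite /dih_mul /= ?oppr0 add0r. Qed.
Fact dih_mulV : left_inverse (false, 0) dih_inv dih_mul.
Proof. by case=> [[] i]; rewrite /dih_mul /= addNr. Qed.
HB.instance Definition _ := Finite_isGroup.Build dih dih_mulA dih_mul1 dih_mulV.

Lemma card_dih : (1 < m)%N -> #|{: dih}| = (2 * m)%N.
Proof. by move=> m1; rewrite card_prod card_bool card_ord Zp_cast. Qed.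

End DihedralGroup.

(** * Fourier transform on the cyclic group *)

Section Fourier.
Variables (m : nat) (m1 : (1 < m)%N).

Lemma expr_ZpD (z : algC) (i j : 'Z_m) : z ^+ m = 1 ->
  z ^+ (i + j)%R = z ^+ i * z ^+ j.
Proof.
move=> zm; have zm' : z ^+ (Zp_trunc m).+2 = 1 by rewrite Zp_cast.
by rewrite -exprD /= (expr_mod _ zm').
Qed.

Lemma expr_ZpN (z : algC) (i : 'Z_m) : z ^+ m = 1 -> z ^+ (- i)%R = z^-1 ^+ i.
Proof.
move=> zm; have := expr_ZpD (- i) i zm; rewrite addNr expr0 => E.
have zi0 : z ^+ i != 0 by apply: contra_eqN E => /eqP ->; rewrite mulr0 oner_eq0.
by rewrite exprVn -[LHS](mulfK zi0) -E mul1r.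
Qed.

(** Orthogonality of characters: for [i != j] the ratio [r] is an [m]-th root of unity other than 1,
    so its geometric sum vanishes. *)
Lemma fourier_inversion (z : algC) (w : 'Z_m -> algC) (j : 'Z_m) :
  m.-primitive_root z ->
  \sum_(k < m) (\sum_(i : 'Z_m) w i * (z ^+ k) ^+ i) * (z ^+ k) ^- j = m%:R * w j.
Proof.
move=> pz.
under eq_bigr do rewrite mulr_suml.
rewrite exchange_big (bigD1 j) //= [X in _ + X]big1 ?addr0.
  have z0 : z != 0.
    apply: contra_eqN (prim_expr_order pz) => /eqP ->.
    by rewrite expr0n gtn_eqF ?(ltnW m1) // eq_sym oner_eq0.
  under eq_bigr do rewrite mulfK ?expf_neq0 ?expf_neq0 //.
  by rewrite sumr_const card_ord mulr_natl.
move=> i nij.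
pose r := z ^+ i / z ^+ j.
rewrite (eq_bigr (fun k : 'I_m => w i * r ^+ k)); last first.
  by move=> k _; rewrite -mulrA /r expr_div_n -!exprM ![(k * _)%N]mulnC.
rewrite -mulr_sumr; have /eqP : (r - 1) * (\sum_(k < m) r ^+ k) = 0.
  rewrite -subrX1 expr_div_n -!exprM ![(_ * m)%N]mulnC !exprM (prim_expr_order pz).
  by rewrite !expr1n divr1 subrr.
rewrite mulf_eq0 subr_eq0 => /orP[|/eqP ->]; last by rewrite mulr0.
rewrite /r => /eqP/divr1_eq/eqP; rewrite (eq_prim_root_expr pz).
have lt_m (k : 'Z_m) : (k < m)%N by have := ltn_ord k; rewrite [X in (_ < X)%N]Zp_cast.
by rewrite !modn_small // => /eqP/val_inj E; rewrite E eqxx in nij.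
Qed.
End Fourier.

Lemma big_dih m (R : Type) (idx : R) (op : Monoid.com_law idx) (P : pred (dih m))
    (F : dih m -> R) :
  \big[op/idx]_(c : dih m | P c) F c =
  op (\big[op/idx]_(i | P (false, i)) F (false, i))
     (\big[op/idx]_(i | P (true, i)) F (true, i)).
Proof.
transitivity (\big[op/idx]_p \big[op/idx]_i if P (p, i) then F (p, i) else idx).
  by rewrite pair_bigA [LHS]big_mkcond; apply: eq_bigr => -[].
by rewrite big_bool Monoid.mulmC -!big_mkcond.
Qed.

(** * The kernel of a dihedral Cayley graph *)

Section DihedralNut.
Variables (m : nat) (S T : {set 'Z_m}) (k d : algC).
Hypotheses (m1 : (1 < m)%N) (S0 : 0 \notin S) (SN : forall i, i \in S -> - i \in S).
Let X (z : algC) := \sum_(i in S) z ^+ i.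
Let Y (z : algC) := \sum_(i in T) z ^+ i.
Hypotheses (km : k ^+ m = 1) (k2 : k ^+ 2 = 1) (d2 : d ^+ 2 = 1).
Hypotheses (XYk : X k + d * Y k = 0) (Xk : X k != 0).
Hypothesis XY : forall z, z ^+ m = 1 -> z != k -> X z ^+ 2 != Y z * Y z^-1.

Definition dih_set : {set dih m} := [set c | if c.1 then c.2 \in T else c.2 \in S].

Let SNE i : (- i \in S) = (i \in S).
Proof. by apply/idP/idP=> [/SN|/SN //]; rewrite opprK. Qed.

Let XV z : z ^+ m = 1 -> X z^-1 = X z.
Proof.
move=> zm; rewrite /X [RHS](reindex_inj oppr_inj) /=.
by apply: eq_big => i; rewrite ?SNE // => _; rewrite (expr_ZpN m1).
Qed.

Lemma dih_set_cayley : cayley_set dih_set.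
Proof. by split=> [|[[] i]]; rewrite !inE /= ?SNE. Qed.

Lemma card_dih_set : #|dih_set| = (#|S| + #|T|)%N.
Proof.
rewrite -!sum1_card big_dih.
by congr (_ + _)%N; apply: eq_bigl => i; rewrite inE.
Qed.

Lemma sum_dih_set (w : dih m -> algC) (x : dih m) :
  \sum_(c in dih_set) w (c * x)%g =
  \sum_(s in S) w (x.1, s + x.2) + \sum_(t in T) w (~~ x.1, (if x.1 then - t else t) + x.2).
Proof.
rewrite big_dih; congr (_ + _).
  case: x => [[] j] /=; last by apply: eq_big => i; rewrite ?inE.
  rewrite [RHS](reindex_inj oppr_inj) /=.
  by apply: eq_big => i; rewrite ?inE ?SNE.
by case: x => [[] j] /=; apply: eq_big => i; rewrite ?inE.
Qed.

(** The character given by the exceptional root [k], extended to reflections with the factor [d];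
    its entries are signs because [k] and [d] square to 1. *)
Let v (x : dih m) : algC := (if x.1 then d else 1) * k ^+ x.2.

Let k0 : k != 0.
Proof. by apply: contra_eqN k2 => /eqP ->; rewrite expr0n eq_sym oner_eq0. Qed.
Let d0 : d != 0.
Proof. by apply: contra_eqN d2 => /eqP ->; rewrite expr0n eq_sym oner_eq0. Qed.
Let kV : k^-1 = k.
Proof. by rewrite -[LHS]mul1r -k2 expr2 mulfK. Qed.

Let adj_null_v : adj_null (cayley_rel dih_set) v.
Proof.
apply/adj_null_cayleyE => x; rewrite sum_dih_set /v /=.
transitivity ((if x.1 then d else 1) * k ^+ x.2 * (X k + d * Y k)); last by rewrite XYk mulr0.
rewrite mulrDr; congr (_ + _).
  by rewrite mulr_sumr; apply: eq_bigr => s _; rewrite (expr_ZpD m1) //; ring.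
rewrite mulrA mulr_sumr; apply: eq_bigr => s _; rewrite (expr_ZpD m1) //.
case: x.1 => /=; last by ring.
rewrite (expr_ZpN m1) // kV; transitivity (d ^+ 2 * (k ^+ s * k ^+ x.2)); last by ring.
by rewrite d2.
Qed.

Let fourier (w : dih m -> algC) p (z : algC) := \sum_(i : 'Z_m) w (p, i) * z ^+ i.

Let fourier_shift (w : dih m -> algC) p z (s : 'Z_m) : z ^+ m = 1 ->
  \sum_j w (p, s + j) * z ^+ j = z^-1 ^+ s * fourier w p z.
Proof.
move=> zm; rewrite /fourier [in RHS](reindex_inj (addrI s)) mulr_sumr /=.
apply: eq_bigr => j _; rewrite (expr_ZpD m1) // mulrCA; congr (_ * _).
rewrite mulrA -expr_ZpN // -expr_ZpD // addNr expr0 mul1r //.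
Qed.

(** Transforming the rotation and the reflection part separately turns adjacency into one 2 by 2
    system for each [z], with determinant [X(z)^2 - Y(z) Y(1/z)]. *)
Let fourier_eq w z : adj_null (cayley_rel dih_set) w -> z ^+ m = 1 ->
  X z * fourier w false z + Y z^-1 * fourier w true z = 0 /\
  Y z * fourier w false z + X z * fourier w true z = 0.
Proof.
move=> /adj_null_cayleyE kw zm.
have E p : X z * fourier w p z +
    \sum_(t in T) z^-1 ^+ (if p then - t else t)%R * fourier w (~~ p) z = 0.
  transitivity (\sum_j (\sum_(c in dih_set) w (c * ((p, j) : dih m))%g) * z ^+ j).
    under [RHS]eq_bigr do rewrite sum_dih_set mulrDl !mulr_suml /=.
    rewrite big_split /=; congr (_ + _); rewrite [RHS]exchange_big /=.
      by rewrite -XV // mulr_suml; apply: eq_bigr => s _; rewrite fourier_shift.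
    by apply: eq_bigr => t _; rewrite fourier_shift.
  by rewrite big1 // => j _; rewrite kw mul0r.
split; first by have := E false; rewrite -mulr_suml.
have YE : \sum_(t in T) z^-1 ^+ (- t)%R = Y z.
  by apply: eq_bigr => t _; rewrite expr_ZpN // ?invrK // exprVn zm invr1.
by have := E true; rewrite -mulr_suml /= YE addrC.
Qed.

Let span_v w : adj_null (cayley_rel dih_set) w -> exists c, forall x, w x = c * v x.
Proof.
move=> kw; have mC : (m%:R : algC) != 0 by rewrite pnatr_eq0; lia.
have hat0 z p : z ^+ m = 1 -> z != k -> fourier w p z = 0.
  move=> zm zk; have [E1 E2] := fourier_eq kw zm.
  have /eqP D := XY zm zk.
  have D0 : X z ^+ 2 - Y z * Y z^-1 != 0 by rewrite subr_eq0; apply/eqP.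
  apply/eqP; rewrite -(mulrI_eq0 _ (mulfI D0)); apply/eqP; case: p.
    transitivity (X z * (Y z * fourier w false z + X z * fourier w true z) -
       Y z * (X z * fourier w false z + Y z^-1 * fourier w true z)); first by ring.
    by rewrite E1 E2 !mulr0 subrr.
  transitivity (X z * (X z * fourier w false z + Y z^-1 * fourier w true z) -
    Y z^-1 * (Y z * fourier w false z + X z * fourier w true z)); first by ring.
  by rewrite E1 E2 !mulr0 subrr.
(* At [z = k] the system is singular, but since [X k] is nonzero it still fixes the ratio [d] of the
   two transforms. *)
have hatk : fourier w true k = d * fourier w false k.
  have [E _] := fourier_eq kw km; move: E; rewrite kV => E.
  have EY : Y k = - d * X k.
    transitivity (d * (X k + d * Y k) - d * X k + (1 - d ^+ 2) * Y k); first by ring.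
    by rewrite XYk d2 subrr mul0r addr0 mulr0 sub0r mulNr.
  have EX : X k * fourier w false k = d * (X k * fourier w true k).
    by apply/eqP; rewrite -subr_eq0 -E EY; apply/eqP; ring.
  apply: (mulfI Xk); transitivity (d ^+ 2 * (X k * fourier w true k)).
    by rewrite d2 mul1r.
  by rewrite [RHS]mulrCA EX; ring.
have [z pz] := C_prim_root_exists (ltnW m1).
have [a ka] := prim_rootP pz km.
(* Only the frequency [k] survives in the inversion formula. *)
have inv p j : w (p, j) = m%:R^-1 * fourier w p k * k ^+ j.
  have E : \sum_(i < m) fourier w p (z ^+ i) * (z ^+ i) ^- j = m%:R * w (p, j).
    have := fourier_inversion m1 (fun i => w (p, i)) j pz. by [].
  apply: (mulfI mC); rewrite -E (bigD1 a) //= big1 => [|i ia]; last first.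
    rewrite hat0 ?mul0r //; first by rewrite exprAC (prim_expr_order pz) expr1n.
    by apply: contra ia => /eqP; rewrite ka => /eqP; rewrite (eq_prim_root_expr pz) !modn_small.
  by rewrite addr0 -ka -exprVn kV -mulrA mulVKf.
exists (m%:R^-1 * fourier w false k) => [[[] j]]; rewrite /v inv /= ?mul1r //.
by rewrite hatk; ring.
Qed.

Lemma NCay_dihedral : NCay (#|S| + #|T|) (2 * m).
Proof.
rewrite -card_dih_set -(card_dih m1).
apply: (NCay_of_group (v := v)) => //; first exact: dih_set_cayley.
  by rewrite (card_dih m1); lia.
by case=> p i; rewrite /v mulf_neq0 ?expf_neq0 //; case: ifP; rewrite ?oner_eq0.
Qed.
End DihedralNut.

(** * Roots of unity modulo 2 *)

Definition Aeven : {pred algC} := fun x => x / 2 \in Aint.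

Lemma AevenE x : (x \in Aeven) = (x / 2 \in Aint). Proof. by []. Qed.
Lemma AevenD x y : x \in Aeven -> y \in Aeven -> x + y \in Aeven.
Proof. by rewrite !AevenE mulrDl => hx hy; rewrite rpredD. Qed.
Lemma AevenN x : x \in Aeven -> - x \in Aeven.
Proof. by rewrite !AevenE mulNr => hx; rewrite rpredN. Qed.
Lemma AevenMl x y : x \in Aint -> y \in Aeven -> x * y \in Aeven.
Proof. by rewrite !AevenE -mulrA => hx hy; rewrite rpredM. Qed.
Lemma Aeven_double x : x \in Aint -> 2 * x \in Aeven.
Proof. by rewrite AevenE (mulrC 2) mulfK // pnatr_eq0. Qed.
Lemma Aeven0 : 0 \in Aeven.
Proof. by rewrite AevenE mul0r rpred0. Qed.
Lemma Aeven_nat n : n%:R \in Aeven -> ~~ odd n.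
Proof.
rewrite AevenE => /Cint_rat_Aint; rewrite rpred_div ?rpred_nat // => /(_ isT)/intrP[k Hk].
have /eqP : (n%:R : algC) = (k * 2)%:~R.
  by rewrite intrM -Hk divfK // pnatr_eq0.
by rewrite -[n%:R]/(n%:~R) eqr_int => /eqP; lia.
Qed.

Lemma root1_Aint m z : (0 < m)%N -> z ^+ m = 1 -> z \in Aint.
Proof. by move=> m0 zm; apply: (Aint_unity_root m0); apply/unity_rootP. Qed.

Lemma geo_Aint z k : z \in Aint -> \sum_(i < k) z ^+ i \in Aint.
Proof. by move=> zA; apply: rpred_sum => i _; apply: rpredX. Qed.

Lemma Aeven_1subX z k : z \in Aint -> 1 - z \in Aeven -> 1 - z ^+ k \in Aeven.
Proof.
move=> zA ze; rewrite -opprB subrX1 -mulNr opprB mulrC.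
by apply: AevenMl ze; apply: geo_Aint.
Qed.

(* [q] is the sum of the [1 - y ^+ i], [i < q]. *)
Lemma prim_root_Aeven q y : (1 < q)%N -> q.-primitive_root y -> 1 - y \in Aeven -> ~~ odd q.
Proof.
move=> q1 py ye; have yA := Aint_prim_root py.
apply: Aeven_nat.
have S0 : \sum_(i < q) y ^+ i = 0.
  have y1 : y - 1 != 0 by rewrite subr_eq0 -[y]expr1 -(prim_order_dvd py) dvdn1 gtn_eqF.
  by apply: (mulfI y1); rewrite -subrX1 (prim_expr_order py) subrr mulr0.
have -> : q%:R = \sum_(i < q) (1 - y ^+ i).
  by rewrite sumrB S0 subr0 sumr_const card_ord.
by elim/big_ind: _ => [|a b|i _]; [exact: Aeven0|exact: AevenD|exact: Aeven_1subX].
Qed.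

(** Let [N] be the order of [z]. All powers of [z] are congruent to 1 modulo 2 as well, which
    excludes odd divisors of [N] above 1 and, through a power [y] with [y^2 = -1], the divisor 4. *)
Lemma root1_mod2 m z : (0 < m)%N -> z ^+ m = 1 -> 1 - z \in Aeven -> z ^+ 2 = 1.
Proof.
move=> m0 zm ze; have zA := root1_Aint m0 zm.
have [N pz _] := prim_order_exists m0 zm.
have N0 := prim_order_gt0 pz.
have root_odd r : (r %| N)%N -> (1 < r)%N -> ~~ odd r.
  move=> rN r1; have py := dvdn_prim_root pz rN.
  by apply: (prim_root_Aeven r1 py); apply: Aeven_1subX.
have N2 : (N %| 2)%N.
  have [r] := @pfactor_coprime 2 N isT N0; rewrite coprime2n => ro NE.
  have r1 : r = 1%N.
    case: (ltngtP r 1) ro => // [|r1]; first by case: (r).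
    by rewrite (negPf (root_odd _ _ r1)) // NE dvdn_mulr.
  rewrite r1 mul1n in NE.
  have [le1|gt1] := leqP (logn 2 N) 1; first by rewrite NE -[X in (_ %| X)%N]expn1 dvdn_exp2l.
  have d4 : (4 %| N)%N by rewrite NE -[4%N]/(2 ^ 2)%N dvdn_exp2l.
  have py := dvdn_prim_root pz d4; set y := z ^+ _ in py.
  have ye : 1 - y \in Aeven by apply: Aeven_1subX.
  have y2 : y ^+ 2 = -1.
    have /eqP : (y ^+ 2 - 1) * (y ^+ 2 + 1) = 0.
      by transitivity (y ^+ 4 - 1); [ring|rewrite (prim_expr_order py) subrr].
    rewrite mulf_eq0 subr_eq0 addr_eq0 => /orP[|/eqP //].
    by rewrite -(prim_order_dvd py).
  have : (1%N)%:R \in Aeven.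
    (* The product is [(1 + y) (1 - y) / 2 = 1], and its first factor is integral because [1 - y] is
       even; so 1 would be even. *)
    have -> : (1%N)%:R = (1 - (1 - y) / 2) * (1 - y).
      transitivity ((1 - y ^+ 2) / 2); last by field.
      by rewrite y2; field.
    by apply: AevenMl => //; rewrite rpredB // rpred1.
  by move/Aeven_nat.
by apply/eqP; rewrite -(prim_order_dvd pz).
Qed.

(* The contribution of the pair [j], [m - j] to a sum over exponents when [z ^+ m = 1]. *)
Definition rc (z : algC) (j : nat) : algC := z ^+ j + z ^- j.

(** Bezout gives [k] with [u k] congruent to -1 modulo [m], so [(z^u)^k = 1/z] and [1 - z^u] divides
    [1/z - 1]. *)
Lemma coprime_1sub m u z : (0 < m)%N -> z ^+ m = 1 -> coprime u m ->
  exists2 a, a \in Aint & 1 - z = a * (1 - z ^+ u).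
Proof.
move=> m0 zm cum; have zA := root1_Aint m0 zm.
have [k _ /dvdnP[q E]] := Bezoutl u m0; move: E; rewrite gcdnC (eqP cum) => E.
exists (- z * \sum_(i < k) (z ^+ u) ^+ i).
  by rewrite rpredM ?rpredN // geo_Aint // rpredX.
transitivity (z * ((z ^+ u) ^+ k - 1)); last by rewrite subrX1; ring.
have H : z * (z ^+ u) ^+ k = 1 by rewrite -exprM mulnC -exprS -add1n E mulnC exprM zm expr1n.
by rewrite mulrBr H mulr1.
Qed.

(** Squaring is additive modulo 2, so [1 - z^2] is even and [root1_mod2] applies to [z^2]. *)
Lemma root1_sub1sq_mod2 m z : (0 < m)%N -> z ^+ m = 1 -> (1 - z) ^+ 2 \in Aeven -> z ^+ 4 = 1.
Proof.
move=> m0 zm ze; have zA := root1_Aint m0 zm.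
have -> : z ^+ 4 = (z ^+ 2) ^+ 2 by rewrite -exprM.
apply: (root1_mod2 m0); first by rewrite exprAC zm expr1n.
have -> : 1 - z ^+ 2 = (1 - z) ^+ 2 + 2 * (z - z ^+ 2) by ring.
by rewrite AevenD // Aeven_double // rpredB // rpredX.
Qed.

Lemma root1_neq0 m (z : algC) : (0 < m)%N -> z ^+ m = 1 -> z != 0.
Proof.
move=> m0 zm; apply: contra_eqN zm => /eqP ->.
by rewrite expr0n gtn_eqF // eq_sym oner_eq0.
Qed.

(** Rests on [z^a (rc z a - rc z b) = (z^(a+b) - 1) (z^(a-b) - 1)], where by coprimality both
    factors divide [1 - z]. *)
Lemma rc_sub_mod2 m a b z : (0 < m)%N -> z ^+ m = 1 -> (b <= a)%N ->
  coprime (a + b) m -> coprime (a - b) m -> rc z a - rc z b \in Aeven -> z ^+ 4 = 1.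
Proof.
move=> m0 zm ba cp cm Ev; apply: (root1_sub1sq_mod2 m0 zm).
have zA := root1_Aint m0 zm; have z0 := root1_neq0 m0 zm.
have [u uA Eu] := coprime_1sub m0 zm cp; have [v vA Ev'] := coprime_1sub m0 zm cm.
have -> : (1 - z) ^+ 2 = u * v * z ^+ a * (rc z a - rc z b).
  have zb : z ^+ b != 0 by rewrite expf_neq0.
  have zd : z ^+ (a - b) != 0 by rewrite expf_neq0.
  have Ea : z ^+ a = z ^+ (a - b) * z ^+ b by rewrite -exprD subnK.
  rewrite expr2 {1}Eu Ev' /rc exprD Ea; move: (z ^+ b) (z ^+ (a - b)) zb zd => A D A0 D0.
  by rewrite invfM; field; rewrite A0.
by rewrite AevenMl // !rpredM // rpredX.
Qed.

Lemma rc1_mod2 m z : (0 < m)%N -> z ^+ m = 1 -> rc z 1 \in Aeven -> z ^+ 4 = 1.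
Proof.
move=> m0 zm Ev; apply: (root1_sub1sq_mod2 m0 zm).
have zA := root1_Aint m0 zm; have z0 := root1_neq0 m0 zm.
have -> : (1 - z) ^+ 2 = z * rc z 1 + 2 * - z by rewrite /rc !expr1; field.
by apply: AevenD; [exact: AevenMl|rewrite Aeven_double // rpredN].
Qed.

(** * Connection sets given by lists of exponents *)

Definition zsum (s : seq nat) (z : algC) : algC := \sum_(j <- s) z ^+ j.

Section ZpSeq.
Variables (m : nat) (m1 : (1 < m)%N) (s : seq nat).
Hypotheses (us : uniq s) (sm : all (fun j => j < m)%N s).

Definition Zp_set : {set 'Z_m} := [set i : 'Z_m | (i : nat) \in s].

Lemma big_Zp_set (R : Type) (idx : R) (op : Monoid.com_law idx) (f : nat -> R) :
  \big[op/idx]_(i in Zp_set) f i = \big[op/idx]_(j <- s) f j.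
Proof.
pose q := [seq (inord j : 'Z_m) | j <- s].
have qs : map (@nat_of_ord _) q = s.
  rewrite -map_comp map_id_in // => j js /=.
  by rewrite inordK // Zp_cast // (allP sm).
have uq : uniq q by move: us; rewrite -[X in uniq X]qs => /map_uniq.
rewrite -[in RHS]qs big_map big_uniq //; apply: eq_bigl => i.
by rewrite inE -[X in _ \in X]qs mem_map //; apply: val_inj.
Qed.

Lemma card_Zp_set : #|Zp_set| = size s.
Proof. by rewrite -sum1_card (big_Zp_set _ (fun=> 1%N)) sum1_size. Qed.

End ZpSeq.

Lemma NCay_dihedral_seq m (s t : seq nat) (k d : algC) : (1 < m)%N ->
  uniq s -> uniq t -> all (fun j => 0 < j < m)%N s -> all (fun j => j < m)%N t ->
  {in s, forall j, (m - j)%N \in s} ->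
  k ^+ m = 1 -> k ^+ 2 = 1 -> d ^+ 2 = 1 ->
  zsum s k + d * zsum t k = 0 -> zsum s k != 0 ->
  (forall z, z ^+ m = 1 -> z != k -> zsum s z ^+ 2 != zsum t z * zsum t z^-1) ->
  NCay (size s + size t) (2 * m).
Proof.
move=> m1 us ut sm0 tm sN km k2 d2 stk sk st.
have sm : all (fun j => j < m)%N s by apply: sub_all sm0 => j /andP[].
rewrite -(card_Zp_set m1 us sm) -(card_Zp_set m1 ut tm).
have E q z : uniq q -> all (fun j => j < m)%N q -> \sum_(i in Zp_set m q) z ^+ i = zsum q z.
  by move=> uq qm; exact: (big_Zp_set m1 uq qm _ (fun j => z ^+ j)).
apply: (NCay_dihedral (k := k) (d := d)) => //; rewrite ?E //.
- by rewrite inE; apply/negP => /(allP sm0).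
- move=> i; rewrite !inE => si.
  have := allP sm0 _ si; have := sN _ si.
  have -> : (- i)%R = ((m - i) %% m)%N :> nat.
    by rewrite /=; congr ((_ - _) %% _)%N; apply: Zp_cast.
  by move=> si' /andP[i0 im]; rewrite modn_small //; lia.
- by move=> z zm zk; rewrite !E //; exact: st.
Qed.

Definition pairs (m : nat) (L : seq nat) : seq nat := L ++ [seq (m - j)%N | j <- L].
Definition rcsum (L : seq nat) (z : algC) : algC := \sum_(j <- L) rc z j.

Lemma rcV z j : rc z^-1 j = rc z j.
Proof. by rewrite /rc !exprVn invrK addrC. Qed.

Section Pairs.
Variables (m : nat) (L : seq nat).
Hypothesis (Lm : all (fun j => (0 < j) && (2 * j < m))%N L).

Lemma pairs_uniq : uniq L -> uniq (pairs m L).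
Proof.
move=> uL; rewrite cat_uniq uL map_inj_in_uniq ?uL ?andbT /=; last first.
  by move=> i j /(allP Lm) + /(allP Lm); lia.
by apply/hasPn=> x /mapP[j /(allP Lm) jm ->]; apply/negP => /(allP Lm); lia.
Qed.

Lemma pairs_range : all (fun j => (0 < j < m) && (2 * j != m))%N (pairs m L).
Proof.
rewrite all_cat; apply/andP; split; apply/allP => x; first by move/(allP Lm); lia.
by move/mapP=> [j /(allP Lm) jm ->]; lia.
Qed.

Lemma pairs_sym : {in pairs m L, forall j, (m - j)%N \in pairs m L}.
Proof.
move=> x; rewrite !mem_cat => /orP[xL|/mapP[j jL ->]]; apply/orP.
  by right; apply: map_f.
by left; rewrite subKn //; have := allP Lm j jL; lia.
Qed.

Lemma size_pairs : size (pairs m L) = (2 * size L)%N.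
Proof. by rewrite size_cat size_map mul2n addnn. Qed.

Lemma zsum_pairs z : (0 < m)%N -> z ^+ m = 1 -> zsum (pairs m L) z = rcsum L z.
Proof.
move=> m0 zm; have z0 := root1_neq0 m0 zm.
rewrite /zsum big_cat big_map /= /rcsum /rc big_split; congr (_ + _); rewrite !big_seq; apply: eq_bigr => j /(allP Lm) jm.
apply: (mulIf (expf_neq0 j z0)); rewrite -exprD subnK ?zm ?mulVf ?expf_neq0 //; lia.
Qed.
End Pairs.

(* [fS] and [fT] collect the self-paired exponents [0] and [m / 2]. *)
Lemma NCay_dihedral_sym m (fS fT LS LT : seq nat) : (1 < m)%N ->
  uniq fS -> uniq fT -> uniq LS -> uniq LT ->
  all (fun j => (0 < j) && (2 * j == m))%N fS -> all (fun j => (j == 0) || (2 * j == m))%N fT ->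
  all (fun j => (0 < j) && (2 * j < m))%N LS -> all (fun j => (0 < j) && (2 * j < m))%N LT ->
  (0 < size fS + size LS)%N -> (size fS + 2 * size LS = size fT + 2 * size LT)%N ->
  (forall z, z ^+ m = 1 -> z != 1 ->
     zsum fS z + rcsum LS z != zsum fT z + rcsum LT z /\
     zsum fS z + rcsum LS z != - (zsum fT z + rcsum LT z)) ->
  NCay (2 * (size fS + 2 * size LS)) (2 * m).
Proof.
move=> m1 ufS ufT uLS uLT fSm fTm LSm LTm s0 sE H.
have m0 := ltnW m1.
set s := fS ++ pairs m LS; set t := fT ++ pairs m LT.
have ss : size s = (size fS + 2 * size LS)%N by rewrite size_cat size_pairs.
have st : size t = (size fS + 2 * size LS)%N by rewrite size_cat size_pairs sE.
have zs z : z ^+ m = 1 -> zsum s z = zsum fS z + rcsum LS z.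
  by move=> zm; rewrite /s /zsum big_cat -(zsum_pairs LSm m0).
have zt z : z ^+ m = 1 -> zsum t z = zsum fT z + rcsum LT z.
  by move=> zm; rewrite /t /zsum big_cat -(zsum_pairs LTm m0).
have z1 q : zsum q 1 = (size q)%:R.
  by rewrite /zsum; under eq_bigr do rewrite expr1n; rewrite big_const_seq count_predT iter_addr_0.
have -> : (2 * (size fS + 2 * size LS) = size s + size t)%N by rewrite ss st mul2n addnn.
have u_cat f L : uniq f -> uniq L -> all (fun j => (j == 0) || (2 * j == m))%N f ->
    all (fun j => (0 < j) && (2 * j < m))%N L -> uniq (f ++ pairs m L).
  move=> uf uL fm Lm; rewrite cat_uniq uf pairs_uniq // andbT /=.
  apply/hasPn=> x /(allP (pairs_range Lm)) /andP[/andP[x0 _] /negPf xm].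
  by apply/negP=> /(allP fm); rewrite xm orbF gtn_eqF.
have fSm' : all (fun j => (j == 0) || (2 * j == m))%N fS by apply: sub_all fSm => j /andP[_ ->]; rewrite orbT.
(* The kernel vector is 1 on rotations and -1 on reflections; it is null because [S] and [T] have
   equal size. *)
apply: (NCay_dihedral_seq (k := 1) (d := -1)) => //; rewrite ?expr1n ?sqrrN ?expr1n //.
- exact: u_cat.
- exact: u_cat.
- rewrite all_cat; apply/andP; split; first by apply: sub_all fSm => j; lia.
  by apply: sub_all (pairs_range LSm) => j /andP[].
- rewrite all_cat; apply/andP; split; first by apply: sub_all fTm => j; lia.
  by apply: sub_all (pairs_range LTm) => j /andP[/andP[]].
- move=> j; rewrite mem_cat => /orP[jf|/(pairs_sym LSm) jL]; rewrite mem_cat ?jL ?orbT //.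
  have /andP[_ /eqP jm] := allP fSm _ jf. by rewrite -jm mul2n -addnn addnK jf.
- by rewrite !z1 ss st mulN1r subrr.
- by rewrite z1 ss pnatr_eq0 addn_eq0 muln_eq0 /= -addn_eq0 -lt0n.
move=> z zm zn1; have [H1 H2] := H z zm zn1.
have zVm : z^-1 ^+ m = 1 by rewrite exprVn zm invr1.
(* [T] is symmetric, so the criterion factors into [X != Y] and [X != - Y]. *)
have -> : zsum t z^-1 = zsum t z.
  rewrite !zt //; congr (_ + _); last by apply: eq_bigr => j _; rewrite rcV.
  rewrite /zsum !big_seq; apply: eq_bigr => j /(allP fTm) /orP[/eqP->|/eqP jm]; first by rewrite !expr0.
  have zj0 : z ^+ j != 0 by rewrite expf_neq0 // (root1_neq0 m0).
  by apply: (mulfI zj0); rewrite exprVn divff // -exprD addnn -mul2n jm.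
by rewrite -expr2 eqf_sqr negb_or zs // zt // H1.
Qed.

(** * The constructions *)

Lemma coprime_root1 m u (z : algC) : (0 < m)%N -> z ^+ m = 1 -> coprime u m -> z ^+ u = 1 -> z = 1.
Proof.
move=> m0 zm cu zu; have [a _ E] := coprime_1sub m0 zm cu.
by apply/eqP; rewrite eq_sym -subr_eq0 E zu subrr mulr0.
Qed.

Lemma root4_cases (z : algC) : z ^+ 4 = 1 -> z != 1 -> z = -1 \/ z ^+ 2 = -1.
Proof.
move=> z4 z1; have /eqP : (z - 1) * ((z + 1) * (z ^+ 2 + 1)) = 0.
  by transitivity (z ^+ 4 - 1); [ring|rewrite z4 subrr].
rewrite mulf_eq0 subr_eq0 (negPf z1) mulf_eq0 !addr_eq0 /=.
by case/orP=> /eqP; [left|right].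
Qed.

Lemma rcN1 j : rc (-1) j = 2 * (-1) ^+ j.
Proof. by rewrite /rc -exprVn invrN1 mulr_natl mulr2n. Qed.

Lemma rc_i z j : z ^+ 2 = -1 -> rc z j = if odd j then 0 else 2 * (-1) ^+ j./2.
Proof.
move=> z2; have z0 : z != 0 by apply: contra_eqN z2 => /eqP ->; rewrite expr0n /= eq_sym oppr_eq0 oner_eq0.
have zV : z^-1 = - z by apply: (mulfI z0); rewrite divff // mulrN -expr2 z2 opprK.
have H w : w ^+ 2 = -1 -> w ^+ j = w ^+ odd j * (-1) ^+ j./2.
  by move=> w2; rewrite -w2 -exprM mul2n -exprD odd_double_half.
rewrite /rc -exprVn zV !H ?sqrrN //; case: (odd j); rewrite ?expr1 ?expr0 ?mul1r.
  by rewrite mulNr subrr.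
by rewrite mulr_natl mulr2n.
Qed.

(** At fourth roots of unity each pair contributes an even integer; the common part of [S] and [T],
    which enters [X + Y] twice, then contributes a multiple of 4. *)
Lemma rc_int4 z j : z ^+ 4 = 1 -> exists k : int, rc z j = 2 * k%:~R.
Proof.
move=> z4; have [->|z1] := eqVneq z 1.
  by exists 1; rewrite /rc expr1n invr1 mulr1.
have [->|z2] := root4_cases z4 z1.
  by exists ((-1) ^+ j); rewrite rcN1 rmorphXn /= rmorphN1.
rewrite rc_i //; case: (odd j); first by exists 0; rewrite mulr0.
by exists ((-1) ^+ j./2); rewrite rmorphXn /= rmorphN1.
Qed.

Lemma rcsum_int4 z L : z ^+ 4 = 1 -> exists k : int, rcsum L z = 2 * k%:~R.
Proof.
move=> z4; elim: L => [|j L [k Hk]]; first by exists 0; rewrite /rcsum big_nil mulr0.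
have [l Hl] := rc_int4 j z4; exists (l + k).
by rewrite /rcsum big_cons Hl -/(rcsum L z) Hk -mulrDr intrD.
Qed.

Lemma rcsum_cons j L z : rcsum (j :: L) z = rc z j + rcsum L z.
Proof. by rewrite /rcsum big_cons. Qed.

Lemma rc_Aint m z j : (0 < m)%N -> z ^+ m = 1 -> rc z j \in Aint.
Proof.
move=> m0 zm; rewrite /rc -exprVn rpredD // rpredX //; first exact: root1_Aint m0 zm.
by apply: (root1_Aint m0); rewrite exprVn zm invr1.
Qed.

Lemma rcsum_Aint m z L : (0 < m)%N -> z ^+ m = 1 -> rcsum L z \in Aint.
Proof. by move=> m0 zm; apply: rpred_sum => j _; exact: rc_Aint m0 zm. Qed.

Lemma zsum_Aint m z L : (0 < m)%N -> z ^+ m = 1 -> zsum L z \in Aint.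
Proof. by move=> m0 zm; apply: rpred_sum => j _; rewrite rpredX // (root1_Aint m0 zm). Qed.

(** With truncated subtraction [(a - b) + (b - a)] is the absolute difference, which spares the
    callers of [rc_sub_mod2] the choice of an order. *)
Lemma rc_sub_even_root4 m a b z : (0 < m)%N -> z ^+ m = 1 ->
  coprime (a + b) m -> coprime ((a - b) + (b - a)) m -> rc z a - rc z b \in Aeven -> z ^+ 4 = 1.
Proof.
move=> m0 zm cp; case: (leqP b a) => [ba|/ltnW ab].
  by have /eqP -> := ba; rewrite addn0; exact: (rc_sub_mod2 m0 zm ba cp).
have /eqP -> := ab; rewrite add0n => cm /AevenN; rewrite opprB.
by apply: (rc_sub_mod2 m0 zm ab) => //; rewrite addnC.
Qed.

(** The common part [U] cancels in [X - Y] and is doubled in [X + Y], so either equation makes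
    [rc z a - rc z b] even, and only fourth roots of unity need the explicit test. *)
Lemma NCay_two_pairs m a b (fS fT U : seq nat) : (1 < m)%N ->
  uniq fS -> uniq fT -> uniq U -> a \notin U -> b \notin U ->
  all (fun j => (0 < j) && (2 * j == m))%N fS -> all (fun j => (j == 0) || (2 * j == m))%N fT ->
  all (fun j => (0 < j) && (2 * j < m))%N [:: a, b & U] -> size fS = size fT ->
  coprime (a + b) m -> coprime ((a - b) + (b - a)) m ->
  (forall z, z ^+ m = 1 -> zsum fS z - zsum fT z \in Aeven) ->
  (forall z, z ^+ m = 1 -> z ^+ 4 = 1 -> z != 1 ->
     zsum fS z + rc z a != zsum fT z + rc z b /\
     zsum fS z + zsum fT z + rc z a + rc z b + 2 * rcsum U z != 0) ->
  NCay (2 * (size fS + 2 * (size U).+1)) (2 * m).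
Proof.
move=> m1 ufS ufT uU aU bU fSm fTm /= /and3P[am bm Um] sf cp cm fE X4.
have m0 := ltnW m1.
apply: (@NCay_dihedral_sym m fS fT (a :: U) (b :: U)); rewrite //= ?aU ?bU ?am ?bm ?uU //.
- by rewrite addnS.
- by rewrite sf.
move=> z zm z1; rewrite !rcsum_cons.
have E4 : rc z a - rc z b \in Aeven -> z ^+ 4 = 1 by exact: (rc_sub_even_root4 m0 zm).
have rA := rc_Aint _ m0 zm; have sA := rcsum_Aint U m0 zm; have zA := zsum_Aint _ m0 zm.
split.
  apply/eqP=> E; have z4 : z ^+ 4 = 1.
    apply: E4; have -> : rc z a - rc z b = - (zsum fS z - zsum fT z).
      have /eqP := E; rewrite -subr_eq0 => /eqP E'.
      by apply/eqP; rewrite -subr_eq0 -E'; apply/eqP; ring.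
    exact/AevenN/fE.
  have [/eqP H _] := X4 z zm z4 z1; apply: H; apply: (addIr (rcsum U z)).
  by rewrite -(addrA _ (rc z a)) -(addrA _ (rc z b)).
apply/eqP=> /eqP; rewrite -subr_eq0 opprK => /eqP E.
have z4 : z ^+ 4 = 1.
  apply: E4; have -> : rc z a - rc z b =
      - (zsum fS z - zsum fT z) + 2 * - (zsum fT z + rc z b + rcsum U z).
    by apply/eqP; rewrite -subr_eq0 -E; apply/eqP; ring.
  apply: AevenD; first exact/AevenN/fE.
  by rewrite Aeven_double // rpredN; apply: rpredD => //; apply: rpredD; rewrite ?zA ?rA.
have [_ /eqP H] := X4 z zm z4 z1; apply: H; rewrite -E; ring.
Qed.

Lemma size_iota_notin k (A : seq nat) : uniq A -> {subset A <= iota 1 k} ->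
  size [seq j <- iota 1 k | j \notin A] = (k - size A)%N.
Proof.
move=> uA sA; rewrite -[X in (X - _)%N](size_iota 1) -(count_predC (mem A) (iota 1 k)) size_filter.
suff -> : count (mem A) (iota 1 k) = size A by rewrite addKn; apply: eq_count.
rewrite -size_filter; apply: perm_size; apply: uniq_perm => //; first by rewrite filter_uniq ?iota_uniq.
by move=> j; rewrite mem_filter /=; case: (boolP (j \in A)) => // /sA ->.
Qed.

Lemma choose_pairs m t (A : seq nat) : uniq A ->
  all (fun j => (0 < j) && (2 * j < m))%N A -> (2 * (t + size A) < m)%N ->
  exists U, [/\ uniq U, size U = t, all (fun j => (0 < j) && (2 * j < m))%N U &
                {in U, forall j, j \notin A}].
Proof.
move=> uA Am tm; have sA : {subset A <= iota 1 m.-1./2}.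
  by move=> j /(allP Am); rewrite mem_iota; lia.
exists (take t [seq j <- iota 1 m.-1./2 | j \notin A]); split.
- by rewrite take_uniq // filter_uniq // iota_uniq.
- by rewrite size_takel // size_iota_notin //; lia.
- by apply/allP=> j /mem_take; rewrite mem_filter mem_iota; lia.
- by move=> j /mem_take; rewrite mem_filter => /andP[].
Qed.

(** A common divisor of [u] and [r] divides a power of two, while both are odd. *)
Lemma coprime_2pow_shift u r e f : odd u -> odd r ->
  [\/ u + 2 ^ f = r, u = r + 2 ^ f | u + r = 2 ^ f]%N -> coprime u (2 ^ e * r).
Proof.
move=> ou or E; have c2 g v : odd v -> coprime v (2 ^ g) by move=> ov; rewrite coprimeXr // coprimen2.
rewrite coprimeMr c2 //=; case: E => [<-|->|E].
- by rewrite /coprime gcdnDl; exact: c2.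
- by rewrite coprime_sym /coprime gcdnDl; exact: c2.
- by rewrite /coprime -(gcdnDl u r) E; exact: c2.
Qed.

(** * Families with [m] odd or twice an odd number *)

Lemma NCay_odd m t : odd m -> (4 + 2 * t < m)%N -> NCay (2 * (2 * t.+1)) (2 * m).
Proof.
move=> om tm; have m1 : (1 < m)%N by lia.
(* Then [a + b = m - 2] and [a - b = 1] are coprime to the odd [m], and no [m]-th root of unity
   other than 1 is a fourth root of unity. *)
pose a := m./2; pose b := (m./2).-1.
have ab : (a + b = m - 2)%N by rewrite /a /b; lia.
have [|||U [uU sU Um UA]] := @choose_pairs m t [:: a; b]; rewrite /= ?inE /a /b; try lia.
have aU : a \notin U by apply/negP=> /UA; rewrite !inE eqxx.
have bU : b \notin U by apply/negP=> /UA; rewrite !inE eqxx orbT.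
rewrite -sU -[(2 * _)%N in X in NCay (2 * X)]add0n.
apply: (@NCay_two_pairs m a b [::] [::] U) => //.
- by rewrite /= Um /a /b; lia.
- rewrite ab -[m in coprime _ m]mul1n -(expn0 2).
  by apply: (@coprime_2pow_shift _ _ _ 1) => //; [lia|constructor 1; lia].
- by have -> : ((a - b) + (b - a) = 1)%N; [rewrite /a /b; lia|rewrite coprime1n].
- by move=> z _; rewrite subrr Aeven0.
move=> z zm z4; have -> : z = 1; last by rewrite eqxx.
apply: (coprime_root1 (ltnW m1) zm _ z4).
by rewrite -[4%N]/(2 ^ 2)%N; apply: coprimeXl; rewrite coprime2n.
Qed.

Lemma odd_int_neq0 (k : int) : 2 * k%:~R + 1 != 0 :> algC.
Proof.
have -> : 2 * k%:~R + 1 = (2 * k + 1)%:~R :> algC by rewrite intrD intrM.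
by rewrite intr_eq0; lia.
Qed.

Lemma algC2_neq0 : 2 != 0 :> algC. Proof. by rewrite pnatr_eq0. Qed.

Lemma root_half_odd h (z : algC) : (0 < h)%N -> odd h -> z ^+ (2 * h) = 1 -> z ^+ 4 = 1 ->
  z != 1 -> z = -1.
Proof.
move=> h0 oh zm z4 z1; have z2 : z ^+ 2 = 1.
  apply: (@coprime_root1 h 2); rewrite -?exprM // coprime2n //.
have /eqP := z2; rewrite -subr_eq0 (_ : z ^+ 2 - 1 = (z - 1) * (z + 1)); last by ring.
by rewrite mulf_eq0 subr_eq0 (negPf z1) addr_eq0 => /eqP.
Qed.

(** Here [S] has the pair of 1 where [T] has the self-paired exponents 0 and [h], whose sum
    [1 + z^h] is 0 or 2. So either equation makes [rc z 1] even, and only [z = -1] remains. *)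
Lemma NCay_twice_odd_even h t : odd h -> (t + 2 <= h)%N ->
  NCay (2 * (2 * t.+1)) (2 * (2 * h)).
Proof.
move=> oh th; have h0 : (0 < h)%N by lia.
have [|||U [uU sU Um UA]] := @choose_pairs (2 * h) t [:: 1%N]; rewrite /= ?inE; try lia.
have aU : 1%N \notin U by apply/negP=> /UA; rewrite inE.
have m0 : (0 < 2 * h)%N by lia.
rewrite -sU -[(2 * _)%N in X in NCay (2 * X)]add0n.
apply: (@NCay_dihedral_sym (2 * h) [::] [:: 0; h]%N (1%N :: U) U); rewrite //= ?inE ?aU ?uU //; try lia.
move=> z zm z1; rewrite rcsum_cons.
have -> : zsum [::] z = 0 by rewrite /zsum big_nil.
have -> : zsum [:: 0; h]%N z = 1 + z ^+ h by rewrite /zsum big_cons big_seq1 expr0.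
rewrite !add0r.
have E4 : rc z 1 \in Aeven -> z = -1.
  by move/(rc1_mod2 m0 zm) => z4; apply: (root_half_odd h0 oh zm z4 z1).
have zh : 1 + z ^+ h \in Aeven.
  have /eqP : (z ^+ h - 1) * (z ^+ h + 1) = 0.
    transitivity ((z ^+ h) ^+ 2 - 1); first by ring.
    by rewrite -exprM mulnC zm subrr.
  rewrite mulf_eq0 subr_eq0 addr_eq0 => /orP[]/eqP ->; last by rewrite subrr Aeven0.
  by rewrite -[1 + 1]mulr1 Aeven_double // rpred1.
have sA := rcsum_Aint U m0 zm.
have zh1 : z = -1 -> z ^+ h = -1 by move=> ->; rewrite -signr_odd oh.
split; apply/eqP.
  move/addIr => E; have zN : z = -1 by apply: E4; rewrite E.
  move/eqP: E; rewrite zh1 // subrr zN rcN1 expr1 mulrN1 oppr_eq0.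
  by rewrite (negPf algC2_neq0).
move/eqP; rewrite -addr_eq0 => /eqP E.
have zN : z = -1.
  apply: E4; have -> : rc z 1 = - (1 + z ^+ h) + 2 * - rcsum U z.
    by apply/eqP; rewrite -subr_eq0 -E; apply/eqP; ring.
  by apply: AevenD; [exact: AevenN|rewrite Aeven_double // rpredN].
have [|k Hk] := @rcsum_int4 z U; first by rewrite zN; ring.
(* At [z = -1] the equation reads [-2 + 4 k = 0]. *)
have /eqP := odd_int_neq0 (k - 1); apply.
apply: (mulfI algC2_neq0); rewrite mulr0 -E Hk zh1 // zN rcN1 expr1 intrB; ring.
Qed.

(** Both sets contain [r = m / 2]. The exponents [r - 3] and 1 have sum [r - 2] and difference
    [r - 4]; their opposite parity separates them at [z = -1]. *)
Lemma NCay_twice_odd_odd r t : odd r -> (5 <= r)%N -> (t + 3 <= r)%N ->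
  NCay (2 * (3 + 2 * t)) (2 * (2 * r)).
Proof.
move=> or r5 tr; have r0 : (0 < r)%N by lia.
have [|||U [uU sU Um UA]] := @choose_pairs (2 * r) t [:: r - 3; 1]%N; rewrite /= ?inE; try lia.
have aU : (r - 3)%N \notin U by apply/negP=> /UA; rewrite !inE eqxx.
have bU : 1%N \notin U by apply/negP=> /UA; rewrite !inE eqxx orbT.
have m0 : (0 < 2 * r)%N by lia.
have -> : (3 + 2 * t = size [:: r] + 2 * (size U).+1)%N by rewrite sU /=; lia.
apply: (@NCay_two_pairs (2 * r) (r - 3)%N 1%N [:: r] [:: r] U) => //=; rewrite ?r0 ?eqxx ?orbT //.
- by lia.
- by rewrite Um; lia.
- rewrite (_ : (2 * r = 2 ^ 1 * r)%N); last by rewrite expn1.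
  by apply: (@coprime_2pow_shift _ _ _ 1) => //; [lia|constructor 1; lia].
- rewrite (_ : (2 * r = 2 ^ 1 * r)%N); last by rewrite expn1.
  by apply: (@coprime_2pow_shift _ _ _ 2) => //; [lia|constructor 1; lia].
- by move=> z _; rewrite subrr Aeven0.
move=> z zm z4 z1; have zN := root_half_odd r0 or zm z4 z1.
have -> : zsum [:: r] z = -1 by rewrite /zsum big_seq1 zN -signr_odd or.
have [k ->] := rcsum_int4 U z4.
have e3 : odd (r - 3) = false by lia.
rewrite zN !rcN1 expr1 -signr_odd e3 expr0; split.
  rewrite (inj_eq (addrI _)) (inj_eq (mulfI algC2_neq0)) -subr_eq0 opprK -[1 + 1]mulr1.
  by rewrite mulf_neq0 ?algC2_neq0 ?oner_eq0.
have -> : -1 + -1 + 2 * 1 + 2 * -1 + 2 * (2 * k%:~R) = 2 * (2 * (k - 1)%:~R + 1) :> algC.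
  by rewrite intrB; ring.
by rewrite mulf_neq0 ?algC2_neq0 ?odd_int_neq0.
Qed.

(** * Extreme degrees: 4 and [2 * m - 4] *)

Lemma rc_inj m a b (z : algC) : (0 < m)%N -> z ^+ m = 1 ->
  coprime (a + b) m -> coprime ((a - b) + (b - a)) m -> rc z a = rc z b -> z = 1.
Proof.
move=> m0 zm; wlog ba : a b / (b <= a)%N => [W|].
  case: (leqP b a) => [|/ltnW] h cp cm E; first exact: (W a b).
  by apply: (W b a) => //; rewrite addnC.
have /eqP -> := ba; rewrite addn0 => cp cm E.
have z0 := root1_neq0 m0 zm.
have zb : z ^+ b != 0 by rewrite expf_neq0.
have zd : z ^+ (a - b) != 0 by rewrite expf_neq0.
have /eqP : (z ^+ (a + b) - 1) * (z ^+ (a - b) - 1) = 0.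
  transitivity (z ^+ a * (rc z a - rc z b)); last by rewrite E subrr mulr0.
  have Ea : z ^+ a = z ^+ (a - b) * z ^+ b by rewrite -exprD subnK.
  rewrite exprD /rc Ea; move: (z ^+ b) (z ^+ (a - b)) zb zd => x y x0 y0.
  by field; rewrite x0.
rewrite mulf_eq0 !subr_eq0 => /orP[] /eqP; exact: (coprime_root1 m0 zm).
Qed.

(** For [S = {1, -1}] and [T = {0, r}] the constants cancel in [X(z)^2 - Y(z) Y(1/z)], which leaves
    [rc z 2 - rc z r]; the sum and difference of 2 and [r] are coprime to [m]. *)
Lemma NCay_degree4 e r : odd r -> (2 <= e)%N -> NCay (2 * 2) (2 * (2 ^ e * r)).
Proof.
move=> or e2; set m := (2 ^ e * r)%N.
have r0 : (0 < r)%N by case: (r) or.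
have m4 : (4 * r <= m)%N by rewrite /m leq_mul2r -[4%N]/(2 ^ 2)%N leq_exp2l // e2 orbT.
have cp : coprime (2 + r) m.
  by apply: (@coprime_2pow_shift _ _ _ 1) => //; [lia|constructor 2; lia].
have cm : coprime ((2 - r) + (r - 2)) m.
  have [r1|r3] := leqP r 1; last by apply: (@coprime_2pow_shift _ _ _ 1) => //; [lia|constructor 1; lia].
  by have -> : ((2 - r) + (r - 2) = 1)%N; [lia|rewrite coprime1n].
clearbody m.
apply: (@NCay_dihedral_seq m [:: 1; (m - 1)]%N [:: 0; r]%N 1 (-1)); rewrite ?expr1n ?sqrrN ?expr1n //=; try (rewrite ?inE; lia).
- by move=> j; rewrite !inE => /orP[]/eqP ->; rewrite ?eqxx ?orbT // subKn ?eqxx //; lia.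
- by rewrite /zsum !big_cons !big_nil !expr1n mulN1r subrr.
- by rewrite /zsum !big_cons !big_nil !expr1n addr0 algC2_neq0.
move=> z zm z1; have m0 : (0 < m)%N by lia.
have z0 := root1_neq0 m0 zm.
have -> : zsum [:: 1; (m - 1)]%N z = rc z 1.
  rewrite /zsum big_cons big_seq1 /rc; congr (_ + _); apply: (mulIf z0).
  by rewrite -exprSr -subSn ?subn1 ?zm ?expr1 ?mulVf.
have zs y : zsum [:: 0; r]%N y = 1 + y ^+ r by rewrite /zsum big_cons big_seq1 expr0.
rewrite !zs -subr_eq0 exprVn.
have -> : rc z 1 ^+ 2 - (1 + z ^+ r) * (1 + z ^- r) = rc z 2 - rc z r.
  rewrite /rc !expr1; move: (z ^+ r) (expf_neq0 r z0) => w w0.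
  by field; rewrite z0 w0.
rewrite subr_eq0; apply: contra_neq z1; exact: rc_inj m0 zm cp cm.
Qed.

(** [S] and [T] are the nonzero exponents without [h] and without [h + 1]. For [z != 1] the full sum
    is -1, and with [w = z^h] the difference in the criterion is [- w (z - 1)^2 / z]. *)
Lemma NCay_codegree4 h : (2 <= h)%N -> NCay (2 * (2 * h - 2)) (2 * (2 * h)).
Proof.
move=> h2; set m := (2 * h)%N; have m0 : (0 < m)%N by lia.
pose q := iota 1 m.-1.
have uq : uniq q by exact: iota_uniq.
have hq : h \in q by rewrite mem_iota; lia.
have h1q : h.+1 \in q by rewrite mem_iota; lia.
have sz x : x \in q -> size (rem x q) = (m - 2)%N by move=> xq; rewrite size_rem // size_iota; lia.
have zq z : z ^+ m = 1 -> z != 1 -> zsum q z = -1.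
  move=> zm z1; have z1' : z - 1 != 0 by rewrite subr_eq0.
  have : \sum_(j < m) z ^+ j = 0 by apply: (mulfI z1'); rewrite -subrX1 zm subrr mulr0.
  rewrite -(big_mkord xpredT (fun j => z ^+ j)) big_ltn // expr0 /index_iota => /eqP.
  by rewrite addr_eq0 subn1 => /eqP E; rewrite /zsum -[LHS]opprK -E.
have zr x z : x \in q -> zsum (rem x q) z = zsum q z - z ^+ x.
  by move=> xq; rewrite /zsum [in RHS](big_rem x) //= addrAC subrr add0r.
have z1 s : zsum s 1 = (size s)%:R.
  by rewrite /zsum; under eq_bigr do rewrite expr1n; rewrite big_const_seq count_predT iter_addr_0.
have -> : (2 * (m - 2) = size (rem h q) + size (rem h.+1 q))%N by rewrite !sz //; lia.
apply: (@NCay_dihedral_seq m (rem h q) (rem h.+1 q) 1 (-1)); rewrite ?expr1n ?sqrrN ?expr1n //; try lia.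
- exact: rem_uniq.
- exact: rem_uniq.
- by apply/allP=> x; rewrite mem_rem_uniq // !inE mem_iota; lia.
- by apply/allP=> x; rewrite mem_rem_uniq // !inE mem_iota; lia.
- by move=> x; rewrite !mem_rem_uniq // !inE !mem_iota; lia.
- by rewrite !z1 !sz // mulN1r subrr.
- by rewrite z1 sz // pnatr_eq0; lia.
move=> z zm zn1; have z0 := root1_neq0 m0 zm.
have zVm : z^-1 ^+ m = 1 by rewrite exprVn zm invr1.
have zVn1 : z^-1 != 1 by rewrite invr_eq1.
rewrite !zr // !zq // exprVn (exprSr z h).
have e2 : z ^+ h * z ^+ h = 1 by rewrite -exprD addnn -mul2n.
have eV : (z ^+ h)^-1 = z ^+ h by apply: (mulfI (expf_neq0 h z0)); rewrite divff ?expf_neq0.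
rewrite invfM eV; move: (z ^+ h) e2 => w e2.
have w0 : w != 0 by apply: contra_eqN e2 => /eqP ->; rewrite mulr0 eq_sym oner_eq0.
rewrite -subr_eq0.
have -> : (-1 - w) ^+ 2 - (-1 - w * z) * (-1 - w / z) = - w * (z - 1) ^+ 2 / z.
  by field.
by rewrite !mulf_neq0 ?oppr_eq0 ?invr_eq0 ?expf_neq0 // subr_eq0.
Qed.

(** * Families with [m] divisible by 4 *)

Lemma count_odd_iota n : count odd (iota 1 n) = n.+1./2.
Proof.
elim: n => // n IH; rewrite -(addn1 n) iotaD count_cat IH /=.
by rewrite add0n addn0 addn1 /= uphalf_half; case: (odd n); rewrite ?addn0 ?add0n ?addn1 ?add1n.
Qed.

Lemma rcsum_const z L c : {in L, forall j, rc z j = c} -> rcsum L z = c * (size L)%:R.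
Proof.
move=> H; rewrite /rcsum big_seq (eq_bigr (fun=> c)) => [|j /H //].
by rewrite -big_seq big_const_seq count_predT iter_addr_0 mulr_natr.
Qed.

Lemma rcsum_cat L1 L2 z : rcsum (L1 ++ L2) z = rcsum L1 z + rcsum L2 z.
Proof. by rewrite /rcsum big_cat. Qed.

Lemma rcsum_even_i z k : z ^+ 2 = -1 ->
  rcsum [seq j <- iota 1 (2 * k.+1).-1 | ~~ odd j] z = -1 + (-1) ^+ k.
Proof.
move=> z2; elim: k => [|k IH]; first by rewrite /= /rcsum big_nil expr0 addNr.
rewrite (_ : (2 * k.+2).-1 = (2 * k.+1).-1 + 2)%N; last by lia.
rewrite iotaD filter_cat rcsum_cat IH (_ : (1 + (2 * k.+1).-1 = k.+1.*2)%N); last by lia.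
have -> q : [seq j <- iota q.*2 2 | ~~ odd j] = [:: q.*2] by rewrite /= odd_double.
rewrite /rcsum big_seq1 rc_i // odd_double doubleK exprS; ring.
Qed.

Section ParityPools.
Variables (k r b : nat).

(* The exponents in [1, 2 k - 1] of each parity that are free for the common part
   of [S] and [T]: [r] and [b] belong to the two pairs in which these differ. *)
Definition odd_pool := rem r [seq j <- iota 1 (2 * k).-1 | odd j].
Definition even_pool := rem b [seq j <- iota 1 (2 * k).-1 | ~~ odd j].

Let uO : uniq [seq j <- iota 1 (2 * k).-1 | odd j].
Proof. by rewrite filter_uniq ?iota_uniq. Qed.
Let uE : uniq [seq j <- iota 1 (2 * k).-1 | ~~ odd j].
Proof. by rewrite filter_uniq ?iota_uniq. Qed.

Lemma mem_odd_pool j : (j \in odd_pool) = [&& odd j, j != r, 0 < j & j < 2 * k]%N.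
Proof. by rewrite mem_rem_uniq // !inE mem_filter mem_iota; lia. Qed.

Lemma mem_even_pool j : (j \in even_pool) = [&& ~~ odd j, j != b, 0 < j & j < 2 * k]%N.
Proof. by rewrite mem_rem_uniq // !inE mem_filter mem_iota; lia. Qed.

Lemma size_odd_pool : odd r -> (0 < r < 2 * k)%N -> size odd_pool = (k - 1)%N.
Proof.
move=> or r0; rewrite size_rem; last by rewrite mem_filter or mem_iota; lia.
by rewrite size_filter count_odd_iota; lia.
Qed.

Lemma size_even_pool : ~~ odd b -> (0 < b < 2 * k)%N -> size even_pool = (k - 2)%N.
Proof.
move=> eb b0; rewrite size_rem; last by rewrite mem_filter eb mem_iota; lia.
have := count_predC odd (iota 1 (2 * k).-1); rewrite count_odd_iota size_iota size_filter.
by rewrite (eq_count (a2 := predC odd)) //; lia.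
Qed.

Lemma pools_uniq : uniq (odd_pool ++ even_pool).
Proof.
rewrite cat_uniq !rem_uniq //= andbT; apply/hasPn=> j; rewrite mem_even_pool => /and4P[oj _ _ _].
by rewrite mem_odd_pool (negPf oj).
Qed.

Lemma pools_range j : odd r -> ~~ odd b -> j \in odd_pool ++ even_pool ->
  [/\ (0 < j) && (2 * j < 4 * k), j != r & j != b]%N.
Proof.
move=> or eb; rewrite mem_cat mem_odd_pool mem_even_pool.
by case/orP=> /and4P[oj jn j0 jk]; split=> //; try lia; apply: contraTneq oj => ->; rewrite ?or ?eb.
Qed.

End ParityPools.

Section Multiple4.
Variables (e r k : nat).
Hypotheses (or : odd r) (kE : (4 * k = 2 ^ e * r)%N).

Let r0 : (0 < r)%N. Proof. by case: (r) or. Qed.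

Lemma coprime_odd_add b f : (b = 2 ^ f)%N -> ~~ odd b ->
  coprime (r + b) (4 * k) /\ coprime ((r - b) + (b - r)) (4 * k).
Proof.
move=> bE eb; rewrite kE; split.
  by apply: (@coprime_2pow_shift _ _ _ f); [lia|lia|constructor 2; rewrite -bE].
apply: (@coprime_2pow_shift _ _ _ f); [lia|lia|rewrite -bE].
by case: (leqP b r) => h; [constructor 1|constructor 3]; lia.
Qed.

(** Takes [a = r] and [b = 2]. At [z^2 = -1] the value of [X + Y] is 2 modulo 4; at [z = -1] the two
    pairs cancel, so the sum over [U] must not vanish. *)
Lemma NCay_4_even t : (r < 2 * k)%N -> (0 < t)%N -> (t + 3 <= 2 * k)%N ->
  NCay (2 * (2 * t.+1)) (2 * (4 * k)).
Proof.
move=> rk t0 tk; have b0 : (0 < 2 < 2 * k)%N by lia.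
have rr : (0 < r < 2 * k)%N by rewrite r0.
have [cp cm] := @coprime_odd_add 2 1 erefl isT.
(* Odd exponents come first, so that [rcsum U (-1)] never vanishes. *)
set P := odd_pool k r ++ even_pool k 2; pose U := take t P.
have sO := size_odd_pool or rr; have sE := @size_even_pool k 2 isT b0.
have sU : size U = t by rewrite size_takel // size_cat sO sE; lia.
have UP j : j \in U -> j \in P by exact: mem_take.
have Pr j := @pools_range k r 2 j or isT.
rewrite -sU -[(2 * _)%N in X in NCay (2 * X)]add0n.
apply: (@NCay_two_pairs (4 * k) r 2 [::] [::] U) => //; first by lia.
- by rewrite take_uniq // pools_uniq.
- by apply/negP=> /UP/Pr[_]; rewrite eqxx.
- by apply/negP=> /UP/Pr[_ _]; rewrite eqxx.
- by rewrite /= r0; apply/and3P; split; [lia|lia|apply/allP=> j /UP/Pr[]].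
- by move=> z _; rewrite subrr Aeven0.
move=> z zm z4 z1; have -> : zsum [::] z = 0 by rewrite /zsum big_nil.
rewrite !add0r; have [zN|z2] := root4_cases z4 z1; last first.
  rewrite !rc_i // or /= expr1 mulrN1 add0r; split; first by rewrite eq_sym oppr_eq0 algC2_neq0.
  have [q ->] := rcsum_int4 U z4.
  have -> : - 2 + 2 * (2 * q%:~R) = 2 * (2 * (q - 1)%:~R + 1) :> algC by rewrite intrB; ring.
  by rewrite mulf_neq0 ?algC2_neq0 ?odd_int_neq0.
rewrite zN !rcN1 -signr_odd or expr1 sqrrN expr1n mulr1 mulrN1; split.
  by rewrite -subr_eq0 -opprD oppr_eq0 -mulr2n mulrn_eq0 algC2_neq0.
rewrite addNr add0r mulf_neq0 ?algC2_neq0 //.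
have O1 L : {subset L <= odd_pool k r} -> rcsum L (-1) = -2 * (size L)%:R.
  move=> sL; apply: rcsum_const => j /sL; rewrite mem_odd_pool // => /and4P[oj _ _ _].
  by rewrite rcN1 -signr_odd oj expr1 mulrN1.
have E1 L : {subset L <= even_pool k 2} -> rcsum L (-1) = 2 * (size L)%:R.
  move=> sL; apply: rcsum_const => j /sL; rewrite mem_even_pool // => /and4P[/negPf oj _ _ _].
  by rewrite rcN1 -signr_odd oj expr0 mulr1.
rewrite /U take_cat; case: ltnP => tO.
  rewrite O1; last by move=> j /mem_take.
  by rewrite mulNr oppr_eq0 mulf_neq0 ?algC2_neq0 // pnatr_eq0 size_takel; [lia|exact: ltnW].
rewrite rcsum_cat O1 // E1; last by move=> j /mem_take.
(* All [k - 1] odd exponents are used, against at most [k - 2] even ones. *)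
rewrite mulNr addrC -mulrBr mulf_neq0 ?algC2_neq0 // subr_eq0 eqr_nat size_takel.
  by move: sO sE tk tO; lia.
by move: sO sE tk tO; lia.
Qed.

(** Takes [a = r] and [b = 4], with [m / 2] in [S] and 0 in [T]. The choice [b = 2] would give
    [X = Y] at [z^2 = -1] for odd [k]. *)
Lemma NCay_4_odd t : (r < 2 * k)%N -> (2 < k)%N -> (t + 3 <= 2 * k)%N ->
  NCay (2 * (3 + 2 * t)) (2 * (4 * k)).
Proof.
move=> rk k2 tk; have b0 : (0 < 4 < 2 * k)%N by lia.
have rr : (0 < r < 2 * k)%N by rewrite r0.
have [cp cm] := @coprime_odd_add 4 2 erefl isT.
(* [U] contains none or all of the even exponents: at [z ^+ 2 = -1], where the odd
   ones contribute [0], only the value [-2] of [rcsum U z] is harmful for even [k]. *)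
set O := odd_pool k r; set E := even_pool k 4.
pose U := if (t <= size O)%N then take t O else E ++ take (t - size E) O.
have sO : size O = _ := size_odd_pool or rr; have sE : size E = _ := @size_even_pool k 4 isT b0.
have sU : size U = t.
  rewrite /U; case: leqP => h; first by rewrite size_takel.
  by rewrite size_cat size_takel sE ?sO; move: h; rewrite sO; lia.
have UP j : j \in U -> j \in O ++ E.
  rewrite /U mem_cat; case: leqP => _; first by move/mem_take ->.
  by rewrite mem_cat => /orP[->|/mem_take ->]; rewrite ?orbT.
have Pr j := @pools_range k r 4 j or isT.
have uOE : uniq (O ++ E) by rewrite pools_uniq.
have -> : (3 + 2 * t = size [:: 2 * k] + 2 * (size U).+1)%N by rewrite sU /=; lia.
apply: (@NCay_two_pairs (4 * k) r 4 [:: 2 * k]%N [:: 0]%N U) => //; try by rewrite /=; lia.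
- move: uOE; rewrite cat_uniq => /and3P[uO OE uE]; rewrite /U; case: leqP => _; first exact: take_uniq.
  rewrite cat_uniq uE take_uniq // andbT; apply: contra OE => /hasP[x /mem_take xO xE].
  by apply/hasP; exists x.
- by apply/negP=> /UP/Pr[_]; rewrite eqxx.
- by apply/negP=> /UP/Pr[_ _]; rewrite eqxx.
- by rewrite /= r0; apply/and3P; split; [lia|lia|apply/allP=> j /UP/Pr[]].
- move=> z zm; rewrite /zsum !big_seq1 expr0.
  have /eqP : (z ^+ (2 * k) - 1) * (z ^+ (2 * k) + 1) = 0.
    transitivity ((z ^+ (2 * k)) ^+ 2 - 1); first by ring.
    by rewrite -exprM (_ : (2 * k * 2 = 4 * k)%N) ?zm ?subrr //; lia.
  rewrite mulf_eq0 subr_eq0 addr_eq0 => /orP[]/eqP ->; first by rewrite subrr Aeven0.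
  by rewrite -opprD AevenN // -[1 + 1]mulr1 Aeven_double // rpred1.
move=> z zm z4 z1; rewrite /zsum !big_seq1 expr0.
have [zN|z2] := root4_cases z4 z1.
  rewrite zN !rcN1 -signr_odd or -[(-1) ^+ (2 * k)]signr_odd mul2n odd_double.
  rewrite -[(-1) ^+ 4]signr_odd /= expr1 expr0; split.
    rewrite -subr_eq0 (_ : _ - _ = - (2 * 2)); last by ring.
    by rewrite oppr_eq0 mulf_neq0 ?algC2_neq0.
  have [q ->] := rcsum_int4 U (etrans (congr1 (fun x => x ^+ 4) (esym zN)) z4).
  rewrite (_ : _ + _ = 2 * (2 * q%:~R + 1)); last by ring.
  by rewrite mulf_neq0 ?algC2_neq0 ?odd_int_neq0.
have z2k : z ^+ (2 * k) = (-1) ^+ odd k by rewrite exprM z2 signr_odd.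
rewrite z2k !rc_i // or (_ : odd 4 = false) // (_ : 4./2 = 2)%N // sqrrN expr1n mulr1 addr0.
have nz (x : algC) (n : nat) : x = n.+1%:R \/ x = - n.+1%:R -> x != 0.
  by case=> ->; rewrite ?oppr_eq0 pnatr_eq0.
split.
  rewrite -subr_eq0; case: (odd k); first by apply: (nz _ 3); right; rewrite expr1; ring.
  by apply: (nz _ 1%N); right; rewrite expr0; ring.
have O0 L : {subset L <= O} -> rcsum L z = 0.
  move=> sL; rewrite (@rcsum_const _ _ 0) ?mul0r // => j /sL; rewrite mem_odd_pool => /and4P[oj _ _ _].
  by rewrite rc_i // oj.
rewrite /U; case: leqP => _.
  rewrite O0; last by move=> j /mem_take.
  case: (odd k); first by apply: (nz _ 1%N); left; rewrite expr1; ring.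
  by apply: (nz _ 3); left; rewrite expr0; ring.
rewrite rcsum_cat (O0 (take _ _)); last by move=> j /mem_take.
(* [E] lacks the exponent 4, whose contribution 2 is subtracted from the full even sum. *)
have -> : rcsum E z = - 3 - (-1) ^+ odd k.
  have k1 : (k.-1.+1 = k)%N by lia.
  have := rcsum_even_i k.-1 z2; rewrite k1 /rcsum (big_rem 4%N) /=; last by rewrite mem_filter mem_iota; lia.
  rewrite rc_i // (_ : 4./2 = 2)%N // sqrrN expr1n mulr1 -/(rcsum _ z) -/(even_pool k 4) -/E.
  move=> /(canRL (addKr _)) ->; rewrite signr_odd -{2}k1 exprS; ring.
case: (odd k); first by apply: (nz _ 1%N); right; rewrite expr1; ring.
by apply: (nz _ 3); right; rewrite expr0; ring.
Qed.
End Multiple4.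

(** * Small orders outside the families *)

Lemma NCay_12_6 : NCay 6 12.
Proof.
(* [T] is not symmetric here, so the general criterion is tested on each factor of [z^6 - 1]. *)
apply: (@NCay_dihedral_seq 6 [:: 1; 3; 5]%N [:: 0; 1; 3]%N 1 (-1)) => //; rewrite ?expr1n ?sqrrN ?expr1n //.
- by move=> j; rewrite !inE => /or3P[]/eqP->.
- by rewrite /zsum !big_cons !big_nil !expr1n mulN1r subrr.
- by rewrite /zsum !big_cons !big_nil !expr1n addr0 -[1 + _]/(3%:R) pnatr_eq0.
move=> z zm z1; rewrite /zsum !big_cons !big_nil !addr0 expr0.
have z0 := @root1_neq0 6 z isT zm.
have /eqP : (z - 1) * ((z + 1) * ((z ^+ 2 + z + 1) * (z ^+ 2 - z + 1))) = 0.
  by transitivity (z ^+ 6 - 1); [ring|rewrite zm subrr].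
rewrite mulf_eq0 subr_eq0 (negPf z1) /= !mulf_eq0 addr_eq0 => /or3P[]/eqP E.
- rewrite E invrN1 -subr_eq0 (_ : _ - _ = 8%:R); last by ring.
  by rewrite pnatr_eq0.
- have z2 : z ^+ 2 = - z - 1 by apply/eqP; rewrite -subr_eq0 -E; apply/eqP; ring.
  have zV : z^-1 = - z - 1 by apply: (mulfI z0); rewrite divff //; ring: z2.
  rewrite zV -subr_eq0 (_ : _ - _ = - 3%:R); last by ring: z2.
  by rewrite oppr_eq0 pnatr_eq0.
- have z2 : z ^+ 2 = z - 1 by apply/eqP; rewrite -subr_eq0 -E; apply/eqP; ring.
  have zV : z^-1 = 1 - z by apply: (mulfI z0); rewrite divff //; ring: z2.
  rewrite zV -subr_eq0 (_ : _ - _ = - 1); last by ring: z2.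
  by rewrite oppr_eq0 oner_eq0.
Qed.

Lemma root8_cases (z : algC) : z ^+ 8 = 1 -> z != -1 -> [\/ z = 1, z ^+ 2 = -1 | z ^+ 4 = -1].
Proof.
move=> z8 z1; have /eqP : (z + 1) * ((z - 1) * ((z ^+ 2 + 1) * (z ^+ 4 + 1))) = 0.
  by transitivity (z ^+ 8 - 1); [ring|rewrite z8 subrr].
rewrite mulf_eq0 addr_eq0 (negPf z1) !mulf_eq0 subr_eq0 !addr_eq0 /=.
by case/or3P=> /eqP; [constructor 1|constructor 2|constructor 3].
Qed.

Lemma root4N1_neq (z : algC) : z ^+ 4 = -1 -> z != -1 /\ z ^+ 2 != -1.
Proof.
move=> z4; have n1 : -1 != 1 :> algC by rewrite eq_sym -subr_eq0 opprK algC2_neq0.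
by split; apply: contra_neq n1 => E; rewrite -[LHS]z4; ring: E.
Qed.

(* For [m = 8] and [S], [T] of equal odd size, some [z != 1] always violates the
   criterion; here the exceptional root of unity is [-1] instead of [1]. *)
Lemma NCay_16_6 : NCay 6 16.
Proof.
apply: (@NCay_dihedral_seq 8 [:: 1; 7]%N [:: 0; 1; 2; 4]%N (-1) 1) => //; rewrite ?expr1n //.
- by move=> j; rewrite !inE => /orP[]/eqP->.
- by ring.
- by ring.
- by rewrite /zsum !big_cons !big_nil; ring.
- rewrite /zsum !big_cons !big_nil (_ : _ + _ = - 2); last by ring.
  by rewrite oppr_eq0 algC2_neq0.
move=> z zm zN1; rewrite /zsum !big_cons !big_nil !addr0 !expr0 !expr1.
have z0 := @root1_neq0 8 z isT zm.
have [->|z2|z4] := root8_cases zm zN1.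
- rewrite invr1 -subr_eq0 (_ : _ - _ = - 12%:R); last by ring.
  by rewrite oppr_eq0 pnatr_eq0.
- have zV : z^-1 = - z by apply: (mulfI z0); rewrite divff //; ring: z2.
  rewrite zV -subr_eq0 (_ : _ - _ = - 2); last by ring: z2.
  by rewrite oppr_eq0 algC2_neq0.
- have zV : z^-1 = - z ^+ 3 by apply: (mulfI z0); rewrite divff //; ring: z4.
  have [_ z2] := root4N1_neq z4.
  rewrite zV -subr_eq0 (_ : _ - _ = z ^+ 3 * (z ^+ 2 + 1)); last by ring: z4.
  by rewrite mulf_neq0 ?expf_neq0 // addr_eq0.
Qed.

(** Same [T] and same exceptional root -1 as in [NCay_16_6]; [S] is everything except 0 and 4. *)
Lemma NCay_16_10 : NCay 10 16.
Proof.
apply: (@NCay_dihedral_seq 8 [:: 1; 2; 3; 5; 6; 7]%N [:: 0; 1; 2; 4]%N (-1) 1) => //; rewrite ?expr1n //.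
- by apply/allP.
- by ring.
- by ring.
- by rewrite /zsum !big_cons !big_nil; ring.
- rewrite /zsum !big_cons !big_nil (_ : _ + _ = - 2); last by ring.
  by rewrite oppr_eq0 algC2_neq0.
move=> z zm zN1; rewrite /zsum !big_cons !big_nil !addr0 !expr0 !expr1.
have z0 := @root1_neq0 8 z isT zm.
have [->|z2|z4] := root8_cases zm zN1.
- rewrite invr1 -subr_eq0 (_ : _ - _ = 20%:R); last by ring.
  by rewrite pnatr_eq0.
- have zV : z^-1 = - z by apply: (mulfI z0); rewrite divff //; ring: z2.
  rewrite zV -subr_eq0 (_ : _ - _ = 2); last by ring: z2.
  exact: algC2_neq0.
- have zV : z^-1 = - z ^+ 3 by apply: (mulfI z0); rewrite divff //; ring: z4.
  have [z1 _] := root4N1_neq z4.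
  rewrite zV -subr_eq0 (_ : _ - _ = z ^+ 3 * (z + 1) ^+ 2); last by ring: z4.
  by rewrite mulf_neq0 ?expf_neq0 // addr_eq0.
Qed.

(** With [s = d / 2] and [m = n / 2], the families are sorted by [m] modulo 4. When 4 divides [m],
    the values [s = 2] and [s = m - 2] are treated apart, since [t] in [NCay_4_even] would be 0 or
    [2 * k - 2]. *)
Lemma NCay_exists s m : (2 <= s)%N -> (s + 2 <= m)%N -> (odd m -> ~~ odd s) ->
  NCay (2 * s) (2 * m).
Proof.
move=> s2 sm oms.
have [om|em] := boolP (odd m).
  have := oms om => es; have -> : s = (2 * (s./2.-1).+1)%N by lia.
  by apply: NCay_odd => //; lia.
have [oh|eh] := boolP (odd m./2).
  have -> : m = (2 * m./2)%N by lia.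
  have [os|es] := boolP (odd s); last first.
    by have -> : s = (2 * (s./2.-1).+1)%N; [lia|apply: NCay_twice_odd_even => //; lia].
  have [h5|h5] := leqP 5 m./2.
    by have -> : s = (3 + 2 * (s - 3)./2)%N; [lia|apply: NCay_twice_odd_odd => //; lia].
  have [-> ->] : s = 3%N /\ m./2 = 3%N by lia.
  exact: NCay_12_6.
have m0 : (0 < m)%N by lia.
have [r] := @pfactor_coprime 2 m isT m0; rewrite coprime2n mulnC => or; set e := logn 2 m => mE.
have e2 : (2 <= e)%N.
  rewrite leqNgt; apply/negP; case: (e) mE => [|[|//]] mE _.
    by move: em; rewrite mE expn0 mul1n or.
  by move: eh; rewrite mE expn1 mul2n doubleK or.
have [->|s2'] := eqVneq s 2; first by rewrite mE; apply: NCay_degree4.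
have [sE|sn] := eqVneq s (m - 2)%N.
  rewrite sE (_ : m = 2 * m./2)%N; last by lia.
  by apply: NCay_codegree4; lia.
pose k := (2 ^ (e - 2) * r)%N.
have kE : (4 * k = 2 ^ e * r)%N by rewrite mulnA -[4%N]/(2 ^ 2)%N -expnD subnKC.
have mk : m = (4 * k)%N by rewrite kE.
have rk : (r <= k)%N by rewrite leq_pmull // expn_gt0.
have k2 : (2 <= k)%N by lia.
have [os|es] := boolP (odd s).
  have [k3|k3] := leqP 3 k.
    rewrite mk (_ : s = 3 + 2 * (s - 3)./2)%N; last by lia.
    by apply: (NCay_4_odd or kE) => //; lia.
  have k2' : k = 2%N by lia.
  have [->|->] : s = 3%N \/ s = 5%N by lia.
    by rewrite mk k2'; exact: NCay_16_6.
  by rewrite mk k2'; exact: NCay_16_10.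
rewrite mk (_ : s = 2 * (s./2.-1).+1)%N; last by lia.
by apply: (NCay_4_even or kE) => //; lia.
Qed.

Lemma Nset_NCay d n : Nset d n -> NCay d n.
Proof.
rewrite /Nset; case: ifP => // /negbT; rewrite negb_or -leqNgt => /andP[ed d4].
case: ifP => d4' [n0 en dn].
  rewrite (_ : d = 2 * d./2)%N; last by lia.
  rewrite (_ : n = 2 * n./2)%N; last by lia.
  by apply: NCay_exists; lia.
rewrite (_ : d = 2 * d./2)%N; last by lia.
rewrite (_ : n = 2 * n./2)%N; last by lia.
by apply: NCay_exists; lia.
Qed.

Theorem mainTheorem1 (d : nat) :
  (forall n : nat, NVT d n <-> Nset d n) /\ (forall n : nat, NCay d n <-> Nset d n).
Proof.
split=> n; split=> [|/Nset_NCay]; [exact: NVT_Nset|exact: NCay_NVT| |by []].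
by move/NCay_NVT/NVT_Nset.
Qed.
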